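(* Let $M$ be a connected, second countable smooth manifold of dimension $n\ge 3$ whose first de Rham cohomology group is trivial, and let $\mathbf{G}$ be a regular spray on $M$ (i.e. a spray defined on all of $TM\setminus\{0\}$). Suppose that $\mathbf{G}$ is of scalar curvature and that its Ricci curvature satisfies $Ric\neq 0$ almost everywhere on $TM\setminus\{0\}$. Then $\mathbf{G}$ is globally metrizable on $M$ if and only if $\mathbf{G}$ is locally metrizable on $M$.
   Context: $T^oM=TM\setminus\{0\}$ is the tangent bundle with the zero section removed; $(x^i,y^i)$ are the coordinates on $TM$ induced by local coordinates $(x^i)$ of $M$; $\partial_k=\partial/\partial x^k$, $\dot\partial_k=\partial/\partial y^k$; repeated indices are summed. A conical set is a subset of $T^oM$ invariant under $(x,y)\mapsto(x,\lambda y)$, $\lambda>0$. A conical region $\mathcal{C}=\bigcup_{x\in M}\mathcal{C}_x$ is an open conical subset of $T^oM$ with (nonempty) fibers $\mathcal{C}_x\subset T_xM\setminus\{0\}$. Spray: a spray on a conical region $\mathcal{C}$ is a smooth vector field on $\mathcal{C}$ of the local form $\mathbf{G}=y^i\frac{\partial}{\partial x^i}-2G^i\frac{\partial}{\partial y^i}$, where $G^i=G^i(x,y)$ is positively homogeneous of degree two in $y$. It is regular if $\mathcal{C}=T^oM$. Curvature: put $G^i_k=\dot\partial_kG^i$, $G^i_{jk}=\dot\partial_k G^i_j$. The Riemann curvature is $R^i_{\ k}=2\partial_kG^i-y^j\partial_jG^i_k+2G^jG^i_{jk}-G^i_jG^j_k$ and the Ricci curvature is $Ric=R^i_{\ i}$.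 $\mathbf{G}$ is of scalar curvature if $R^i_{\ k}=R\,\delta^i_k-\tau_k y^i$ for some functions $R=R(x,y)$, $\tau_k=\tau_k(x,y)$ positively homogeneous in $y$ (then $Ric=(n-1)R$ and $R=\tau_ry^r$). Finsler metric: a Finsler metric on an open conical subset of $T^oM$ is a nowhere zero $C^\infty$ function $L=L(x,y)$ on it, positively homogeneous of degree two in $y$, such that $g_{ij}=(L/2)_{y^iy^j}$ is non-degenerate (no definiteness or positivity is required). It induces the spray with coefficients $G^i=\frac14 g^{il}\{L_{x^ky^l}y^k-L_{x^l}\}$, where $(g^{ij})=(g_{ij})^{-1}$. Metrizability: let $\mathbf{G}$ be a spray defined on $\mathcal{C}$. It is globally metrizable (on $M$, or on $\mathcal{C}$) if there is a Finsler metric $L$ defined on all of $\mathcal{C}$ that induces $\mathbf{G}$. It is locally metrizable if each $(x,y)\in\mathcal{C}$ has an open conical neighborhood $U\subset\mathcal{C}$ such that $\mathbf{G}|_U$ is induced by a Finsler metric on $U$. *)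

(* Defs.v *)
From HB Require Import structures.
From mathcomp Require Import all_boot all_order all_algebra.
From mathcomp Require Import all_classical all_reals all_analysis.
Set Implicit Arguments.
Unset Strict Implicit.
Unset Printing Implicit Defensive.
Import Order.TTheory GRing.Theory Num.Theory.
Import numFieldNormedType.Exports.
Local Open Scope classical_set_scope.
Local Open Scope ring_scope.

(* C^infty on an open set D (of a finite-dimensional space): every iterated
   directional derivative, including f itself (vs = [::]), is differentiable
   at every point of D. *)
Definition smooth_on (R : realType) (V W : normedModType R) (D : set V)
    (f : V -> W) : Prop :=
  forall (vs : seq V) (x : V), D x ->
    differentiable (foldr (fun v (g : V -> W) => (fun z => 'D_v g z)) f vs) x.

Section Manifold.
Variables (R : realType) (n : nat) (M : topologicalType).

Record chart : Type := Chart {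
  cdom : set M;
  cmap : M -> 'rV[R]_n;
  cinv : 'rV[R]_n -> M;
  cdom_open : open cdom;
  cimg_open : open (cmap @` cdom);
  cmap_cont : {within cdom, continuous cmap};
  cinv_cont : {within cmap @` cdom, continuous cinv};
  cmapK : forall x, cdom x -> cinv (cmap x) = x }.

Definition cimg (c : chart) : set 'rV[R]_n := cmap c @` cdom c.

Definition transition (c d : chart) : 'rV[R]_n -> 'rV[R]_n := cmap d \o cinv c.

Record smooth_atlas : Type := SmoothAtlas {
  idx : Type;
  ch : idx -> chart;
  ch_cover : forall x : M, exists i, cdom (ch i) x;
  ch_smooth : forall i j,
    smooth_on (cmap (ch i) @` (cdom (ch i) `&` cdom (ch j)))
              (transition (ch i) (ch j)) }.

End Manifold.

Section TangentBundle.
Variables (R : realType) (n : nat) (M : topologicalType).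
Variable A : smooth_atlas R n M.

(* A preferred chart around each point. *)
Definition chart_at (x : M) : idx A := projT1 (cid (ch_cover A x)).

(* The tangent bundle: (x, v) is the tangent vector at x whose components in
   the preferred chart chart_at x are v.  Its topology is not the product
   topology; see openTM. *)
Definition TM : Type := (M * 'rV[R]_n)%type.

(* Induced coordinates (x^1..x^n, y^1..y^n) on TM. *)
Definition coords : Type := ('rV[R]_n * 'rV[R]_n)%type.

(* The tangent vector with coordinates p = (x^i, y^i) in the chart i; its
   components in the preferred chart are obtained through the Jacobian of the
   coordinate change. *)
Definition tvec (i : idx A) (p : coords) : TM :=
  let x := cinv (ch i) p.1 in
  (x, 'D_(p.2) (transition (ch i) (ch (chart_at x))) p.1).

Definition loc_set (U : set TM) (i : idx A) : set coords :=
  [set p | cimg (ch i) p.1 /\ U (tvec i p)].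

Definition loc_fun (L : TM -> R) (i : idx A) : coords -> R :=
  fun p => L (tvec i p).

Definition T0M : set TM := [set z | z.2 != 0].

Definition openTM (U : set TM) : Prop :=
  forall i, open (loc_set U i : set ('rV[R]_n * 'rV[R]_n)%type).

Definition conical (U : set TM) : Prop :=
  U `<=` T0M /\ forall x v (l : R), 0 < l -> U (x, v) -> U (x, l *: v).

Definition conical_region (C : set TM) : Prop :=
  [/\ openTM C, conical C & forall x, exists v, C (x, v)].

(* Coordinate change of TM between the charts i and j. *)
Definition Ttransition (i j : idx A) (p : coords) : 'rV[R]_n * 'rV[R]_n :=
  (transition (ch i) (ch j) p.1,
   'D_(p.2) (transition (ch i) (ch j)) p.1).

(* Local form of the vector field y^i d/dx^i - 2 G^i d/dy^i. *)
Definition spray_field (G : coords -> 'rV[R]_n) (p : coords) :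
    'rV[R]_n * 'rV[R]_n :=
  (p.2, - (2%:R *: G p)).

(* A spray on C: coefficients G = (G^1..G^n) in every chart, such that the
   local vector fields are related by the differentials of the coordinate
   changes of TM, i.e. define one vector field on C. *)
Record spray (C : set TM) : Type := Spray {
  coef : idx A -> 'rV[R]_n * 'rV[R]_n -> 'rV[R]_n;
  coef_region : conical_region C;
  coef_smooth : forall i, smooth_on (loc_set C i) (coef i);
  coef_homog : forall i x y (l : R), 0 < l -> loc_set C i (x, y) ->
    coef i (x, l *: y) = l ^+ 2 *: coef i (x, y);
  coef_field : forall i j p, loc_set C i p ->
    cdom (ch j) (cinv (ch i) p.1) ->
    spray_field (coef j) (Ttransition i j p) =
      'D_(spray_field (coef i) p) (Ttransition i j) p }.

Definition regular_spray : Type := spray T0M.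

Definition ebasis (k : 'I_n) : 'rV[R]_n := delta_mx 0 k.

(* d/dx^k and d/dy^k on functions of the induced coordinates. *)
Definition dx (k : 'I_n) (F : 'rV[R]_n * 'rV[R]_n -> R) :
    'rV[R]_n * 'rV[R]_n -> R :=
  fun p => 'D_(ebasis k, 0) F p.

Definition dy (k : 'I_n) (F : 'rV[R]_n * 'rV[R]_n -> R) :
    'rV[R]_n * 'rV[R]_n -> R :=
  fun p => 'D_(0, ebasis k) F p.

Section Curvature.
Variables (C : set TM) (G : spray C) (c : idx A).

Definition G1 (i : 'I_n) : coords -> R := fun p => coef G c p 0 i.
Definition G2 (i k : 'I_n) : coords -> R := dy k (G1 i).
Definition G3 (i j k : 'I_n) : coords -> R := dy k (G2 i j).

Definition riemann (i k : 'I_n) (p : coords) : R :=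
  2%:R * dx k (G1 i) p
  - \sum_(j < n) p.2 0 j * dx j (G2 i k) p
  + 2%:R * (\sum_(j < n) G1 j p * G3 i j k p)
  - \sum_(j < n) G2 i j p * G2 j k p.

Definition ricci (p : coords) : R := \sum_(i < n) riemann i i p.

End Curvature.

(* tau c is the vector (tau_1, .., tau_n) of components in the chart c; the
   degrees of homogeneity are those forced by R^i_k being of degree two. *)
Definition scalar_curvature (C : set TM) (G : spray C) : Prop :=
  exists (S : TM -> R) (tau : idx A -> coords -> 'rV[R]_n),
    [/\ forall x v (l : R), 0 < l -> C (x, v) -> S (x, l *: v) = l ^+ 2 * S (x, v),
        forall c x y (l : R), 0 < l -> loc_set C c (x, y) ->
          tau c (x, l *: y) = l *: tau c (x, y)
      & forall c p, loc_set C c p -> forall i k : 'I_n,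
          riemann G c i k p =
            loc_fun S c p * (i == k)%:R - tau c p 0 k * p.2 0 i].

(* Lebesgue-null subsets of R^n x R^n.  The norm is the sup norm, so the ball
   of radius r is a cube of volume (2r)^(2n). *)
Definition null_set (N : set coords) : Prop :=
  forall e : R, 0 < e ->
    exists (a : nat -> 'rV[R]_n * 'rV[R]_n) (r : nat -> R),
      [/\ forall k, 0 < r k,
          N `<=` \bigcup_k ball (a k) (r k)
        & (\sum_(0 <= k <oo) ((2%:R * r k) ^+ (2 * n))%:E <= e%:E)%E].

Definition ricci_neq0_ae (C : set TM) (G : spray C) : Prop :=
  forall (c : idx A), null_set [set p | loc_set C c p /\ ricci G c p = 0].

Definition gmx (L : 'rV[R]_n * 'rV[R]_n -> R) (p : coords) : 'M[R]_n :=
  \matrix_(i, j) dy j (dy i (fun q => L q / 2%:R)) p.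

Definition finsler_metric (U : set TM) (L : TM -> R) : Prop :=
  [/\ openTM U, conical U,
      forall z, U z -> L z != 0
    & [/\ forall (c : idx A), smooth_on (loc_set U c) (loc_fun L c),
          forall x v (l : R), 0 < l -> U (x, v) ->
            L (x, l *: v) = l ^+ 2 * L (x, v)
        & forall (c : idx A) p, loc_set U c p -> gmx (loc_fun L c) p \in unitmx]].

Definition induces (U : set TM) (L : TM -> R) (C : set TM) (G : spray C) :
    Prop :=
  forall (c : idx A) p, loc_set U c p -> forall i : 'I_n,
    coef G c p 0 i =
      4%:R^-1 * \sum_(l < n) invmx (gmx (loc_fun L c) p) i l *
        ((\sum_(k < n) dy l (dx k (loc_fun L c)) p * p.2 0 k)
         - dx l (loc_fun L c) p).

Definition globally_metrizable (C : set TM) (G : spray C) : Prop :=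
  exists L : TM -> R, finsler_metric C L /\ induces C L G.

Definition locally_metrizable (C : set TM) (G : spray C) : Prop :=
  forall z, C z -> exists (U : set TM),
    [/\ openTM U, conical U, U z, U `<=` C
      & exists L : TM -> R, finsler_metric U L /\ induces U L G].

(* One-forms on M, as smooth fibrewise linear functions on TM. *)
Definition one_form (w : TM -> R) : Prop :=
  (forall x (a : R) u v, w (x, a *: u + v) = a * w (x, u) + w (x, v)) /\
  (forall (c : idx A), smooth_on ([set p | cimg (ch c) p.1] :
                          set ('rV[R]_n * 'rV[R]_n)%type) (loc_fun w c)).

Definition closed_form (w : TM -> R) : Prop :=
  forall (c : idx A) (a : 'rV[R]_n), cimg (ch c) a -> forall j k : 'I_n,
    'D_(ebasis j) (fun b => loc_fun w c (b, ebasis k)) a =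
    'D_(ebasis k) (fun b => loc_fun w c (b, ebasis j)) a.

Definition smooth_fun (f : M -> R) : Prop :=
  forall (c : idx A), smooth_on (cimg (ch c)) (f \o cinv (ch c)).

Definition exact_form (w : TM -> R) : Prop :=
  exists f : M -> R, smooth_fun f /\
    forall (c : idx A) a v, cimg (ch c) a ->
      loc_fun w c (a, v) = 'D_v (f \o cinv (ch c)) a.

(* The first de Rham cohomology group, closed modulo exact one-forms, is 0. *)
Definition H1dR_trivial : Prop :=
  forall w, one_form w -> closed_form w -> exact_form w.

End TangentBundle.

(* Main.v *)
Require Import Defs.
From mathcomp Require Import all_boot all_order all_algebra.
From mathcomp Require Import all_classical all_reals all_analysis.
From mathcomp Require Import ring lra.
Set Implicit Arguments.
Unset Strict Implicit.
Unset Printing Implicit Defensive.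
Import Order.TTheory GRing.Theory Num.Theory.
Import numFieldNormedType.Exports.
Local Open Scope classical_set_scope.
Local Open Scope ring_scope.

(* If L induces the spray G on an open conical set, then L is constant along the
   horizontal fields d/dx^k - G^i_k d/dy^i, hence annihilated by the curvature:
   R^i_k dL/dy^i = 0.  For scalar curvature this reads R dL/dy^k = 2 tau_k L, and
   Ric vanishes wherever R does.  So where Ric <> 0 the vertical logarithmic
   derivative of L depends on G only; a null set has empty interior, hence the
   same holds everywhere by continuity, then also for the horizontal derivative.
   Two local metrics therefore have a locally constant quotient: the functions
   log |L| + const form a locally constant sheaf on TM minus the zero section.
   Over a ball in a chart this sheaf has a section Phi_j, because for n >= 3 the
   punctured fibres are simply connected.  The differences Phi_k - Phi_j are
   locally constant functions on the base; a partition of unity writes them as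
   h_j - h_k with h_j smooth, the closed 1-form dh_j is globally defined, hence
   equal to df since the first de Rham group vanishes, and
   L = exp (Phi_j + h_j - f) is a global metric. *)

(** * Smooth calculus *)

(** The curvature hypotheses make the spray determine d log |L|, so a local metric is unique up to a
    nonzero factor and the whole question is one of monodromy: around loops of a punctured fibre,
    and around loops of the base. Neither loops nor simple connectedness are formalised. Germs are
    continued along segments of convex sets, and a punctured fibre is covered by the convex
    half-spaces on which one coordinate has a fixed sign. On the base the obstruction is a Cech
    cocycle of real constants, whereas the hypothesis speaks of closed 1-forms; the passage between
    the two needs bump functions and a countable cover, which is where the Hausdorff and second
    countability assumptions enter. Signs are no obstacle: multiplying [L] by any nonzero constant
    preserves its spray, so the global metric may be sought as an exponential. Homogeneity is not
    part of the gluing either; it is recovered at the end from the connectedness of rays. *)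

Section SmoothCalculus.
Context {R : realType}.
Implicit Types V W : normedModType R.

(* [smooth_on] is [Ck k] for every k; the closure properties need the order k
   for an induction. *)
Fixpoint Ck (k : nat) V W (D : set V) (f : V -> W) : Prop :=
  (forall x, D x -> differentiable f x) /\
  (if k is k'.+1 then forall v, Ck k' D (fun x => 'D_v f x) else True).

Arguments Ck : simpl never.

Lemma CkSP k V W (D : set V) (f : V -> W) :
  Ck k.+1 D f <->
  (forall x, D x -> differentiable f x) /\ forall v, Ck k D (fun x => 'D_v f x).
Proof. by []. Qed.

Lemma CkS_derive k V W (D : set V) (f : V -> W) v :
  Ck k.+1 D f -> Ck k D (fun x => 'D_v f x).
Proof. by move=> /CkSP[_]. Qed.

Lemma Ck_diff k V W (D : set V) (f : V -> W) x :
  Ck k D f -> D x -> differentiable f x.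
Proof. by case: k => [|k] [+ _]; exact. Qed.

Lemma smooth_onS V W (D : set V) (f : V -> W) v :
  smooth_on D f -> smooth_on D (fun x => 'D_v f x).
Proof.
move=> Df vs x Dx; have := Df (rcons vs v) x Dx.
by rewrite foldr_rcons.
Qed.

Lemma smooth_on_diff V W (D : set V) (f : V -> W) x :
  smooth_on D f -> D x -> differentiable f x.
Proof. by move=> Df; exact: (Df [::]). Qed.

Lemma smooth_onP V W (D : set V) (f : V -> W) :
  smooth_on D f <-> forall k, Ck k D f.
Proof.
split=> [Df k|Df vs x Dx].
  elim: k f Df => [|k IH] f Df; first by split=> // x; exact: smooth_on_diff.
  by apply/CkSP; split=> [x|v]; [exact: smooth_on_diff|exact/IH/smooth_onS].
have {Df} := Df (size vs).
elim/last_ind: vs f => [|vs v IH] f; first by move=> [+ _]; exact.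
by rewrite foldr_rcons size_rcons => /(CkS_derive v) /IH.
Qed.

Lemma CkW k V W (D : set V) (f : V -> W) : Ck k.+1 D f -> Ck k D f.
Proof.
elim: k f => [|k IH] f /CkSP[df fk]; first by split.
by apply/CkSP; split=> // v; exact: IH.
Qed.

Lemma open_near V (D : set V) (P : V -> Prop) (x : V) :
  open D -> D x -> (forall y, D y -> P y) -> \forall y \near x, P y.
Proof.
move=> Do Dx DP; have : nbhs x D by exact: open_nbhs_nbhs.
exact: filterS.
Qed.

Lemma near_eq_differentiable V W (f g : V -> W) (x : V) :
  (\near x, f x = g x) -> differentiable f x -> differentiable g x.
Proof.
move=> fg df; have fgx := nbhs_singleton fg.
have [dfc dfe] := (diff_locallyP x f).1 df.
have dge : g \o shift x = cst (g x) + 'd f x +o_ 0 id.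
  apply/eqaddoP => e e0.
  move/eqaddoP : dfe => /(_ e e0) dfe.
  have fg0 : \forall h \near (0:V), f (h + x) = g (h + x).
    by have := fg; rewrite (near_shift 0) subr0.
  near=> h.
  have -> : (g \o shift x - (cst (g x) + 'd f x)) h = (f \o shift x - (cst (f x) + 'd f x)) h.
    by rewrite /= !fctE/= -fgx; congr (_ - _); rewrite (near fg0 h).
  by near: h.
have dE := diff_unique dfc dge.
by apply/diff_locallyP; rewrite dE.
Unshelve. all: by end_near. Qed.

Lemma derive_linear V W (f : V -> W) (x u v : V) (a : R) :
  differentiable f x -> 'D_(a *: u + v) f x = a *: 'D_u f x + 'D_v f x.
Proof. by move=> df; rewrite !deriveE// linearP. Qed.

Lemma derive_comp_vec (U V W : normedModType R) (f : U -> V) (g : V -> W) x v :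
  differentiable f x -> differentiable g (f x) ->
  'D_v (g \o f) x = 'D_('D_v f x) g (f x).
Proof.
move=> df dg; rewrite [LHS]deriveE; last exact: differentiable_comp.
by rewrite diff_comp// [RHS]deriveE// [in RHS]deriveE.
Qed.

Lemma derive_sumv V W (f : V -> W) (x : V) (I : Type) (r : seq I) (c : I -> R) (e : I -> V) :
  differentiable f x ->
  'D_(\sum_(i <- r) c i *: e i) f x = \sum_(i <- r) c i *: 'D_(e i) f x.
Proof.
move=> df; rewrite deriveE// linear_sum; apply: eq_bigr => i _.
by rewrite linearZ /= deriveE.
Qed.

Lemma Ck_eq k V W (D : set V) (f g : V -> W) :
  open D -> (forall x, D x -> f x = g x) -> Ck k D f -> Ck k D g.
Proof.
move=> Do.
have dfg (h1 h2 : V -> W) : (forall x, D x -> h1 x = h2 x) ->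
    (forall x, D x -> differentiable h1 x) -> forall x, D x -> differentiable h2 x.
  move=> h12 dh x Dx; apply: near_eq_differentiable (dh x Dx); exact: open_near h12.
elim: k f g => [|k IH] f g fg.
  by move=> [df _]; split=> //; exact: dfg fg df.
move=> /CkSP[df fk]; apply/CkSP; split; first exact: dfg fg df.
by move=> v; apply: IH (fk v) => x Dx; apply: near_eq_derive; exact: open_near fg.
Qed.

Lemma Ck_sub k V W (D E : set V) (f : V -> W) :
  E `<=` D -> Ck k D f -> Ck k E f.
Proof.
move=> ED; elim: k f => [|k IH] f; first by move=> [df _]; split=> // x /ED /df.
move=> /CkSP[df fk]; apply/CkSP; split=> [x /ED /df //|v]; exact: IH.
Qed.

(** The sets [E] may be arbitrary: [Ck k E f] asks for differentiability of [f] on the ambient space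
    at the points of [E], not of its restriction. *)
Lemma Ck_local k V W (D : set V) (f : V -> W) :
  (forall x, D x -> exists2 E : set V, E x & Ck k E f) -> Ck k D f.
Proof.
elim: k f => [|k IH] f Df; first by split=> // x /Df[E Ex [+ _]]; exact.
apply/CkSP; split=> [x /Df[E Ex /CkSP[+ _]]|v]; first exact.
by apply: IH => x /Df[E Ex /(CkS_derive v)] Ef; exists E.
Qed.

(** * Algebraic closure properties of C^k functions *)

Section RealValued.
Variables (V : normedModType R) (D : set V) (Do : open D).
Implicit Types f g : V -> R.

Lemma Ck_cst k W (c : W) (E : set V) : Ck k E (fun=> c).
Proof.
elim: k c => [|k IH] c; first by split=> // x _; exact: differentiable_cst.
apply/CkSP; split=> [x _|v]; first exact: differentiable_cst.
rewrite (_ : 'D_v (fun=> c) = (fun=> 0)); first exact: IH.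
by apply/funext => x; exact: derive_cst.
Qed.

Lemma CkD k f g : Ck k D f -> Ck k D g -> Ck k D (fun x => f x + g x).
Proof.
elim: k f g => [|k IH] f g Df Dg.
  by split=> // x Dx; apply: differentiableD; [exact: (Ck_diff Df)|exact: (Ck_diff Dg)].
apply/CkSP; split=> [x Dx|v].
  by apply: differentiableD; [exact: (Ck_diff Df)|exact: (Ck_diff Dg)].
apply: (@Ck_eq _ _ _ _ (fun x => 'D_v f x + 'D_v g x)) => //.
  by move=> x Dx; rewrite -deriveD//; apply: diff_derivable; [exact: (Ck_diff Df)|exact: (Ck_diff Dg)].
by apply: IH; exact: CkS_derive.
Qed.

Lemma CkM k f g : Ck k D f -> Ck k D g -> Ck k D (fun x => f x * g x).
Proof.
elim: k f g => [|k IH] f g Df Dg.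
  split=> // x Dx; apply: differentiableM; [exact: (Ck_diff Df)|exact: (Ck_diff Dg)].
apply/CkSP; split=> [x Dx|v].
  by apply: differentiableM; [exact: (Ck_diff Df)|exact: (Ck_diff Dg)].
 apply: (@Ck_eq _ _ _ _ (fun x => f x * 'D_v g x + g x * 'D_v f x)) => //.
  move=> x Dx; rewrite -[RHS]/('D_v (f * g) x) deriveM//; apply: diff_derivable.
    exact: (Ck_diff Df).
  exact: (Ck_diff Dg).
by apply: CkD; apply: IH; do ?[exact: CkW]; exact: CkS_derive.
Qed.

Lemma CkZ k (c : R) f : Ck k D f -> Ck k D (fun x => c * f x).
Proof. by move=> Df; apply: CkM => //; exact: Ck_cst. Qed.

Lemma CkN k f : Ck k D f -> Ck k D (fun x => - f x).
Proof.
move=> /(CkZ (-1)); apply: Ck_eq => // x _; by rewrite mulN1r.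
Qed.

Lemma CkB k f g : Ck k D f -> Ck k D g -> Ck k D (fun x => f x - g x).
Proof. by move=> Df Dg; apply: CkD => //; exact: CkN. Qed.

Lemma Ck_sum k (I : Type) (r : seq I) (F : I -> V -> R) :
  (forall i, Ck k D (F i)) -> Ck k D (fun x => \sum_(i <- r) F i x).
Proof.
move=> DF; elim: r => [|i r IH].
  by apply: (@Ck_eq _ _ _ _ (fun=> 0 : R)) => //; [move=> x _; rewrite big_nil|exact: Ck_cst].
apply: (@Ck_eq _ _ _ _ (fun x => F i x + \sum_(i <- r) F i x)) => //.
  by move=> x _; rewrite big_cons.
exact: CkD.
Qed.

Lemma Ck_prod k (I : Type) (r : seq I) (F : I -> V -> R) :
  (forall i, Ck k D (F i)) -> Ck k D (fun x => \prod_(i <- r) F i x).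
Proof.
move=> DF; elim: r => [|i r IH].
  by apply: (@Ck_eq _ _ _ _ (fun=> 1 : R)) => //; [move=> x _; rewrite big_nil|exact: Ck_cst].
apply: (@Ck_eq _ _ _ _ (fun x => F i x * \prod_(i <- r) F i x)) => //.
  by move=> x _; rewrite big_cons.
exact: CkM.
Qed.

Lemma CkV k f : (forall x, D x -> f x != 0) -> Ck k D f -> Ck k D (fun x => (f x)^-1).
Proof.
move=> f0; elim: k => [|k IH] Df.
  by split=> // x Dx; apply: differentiableV (f0 _ Dx); exact: (Ck_diff Df).
apply/CkSP; split=> [x Dx|v].
  by apply: differentiableV (f0 _ Dx); exact: (Ck_diff Df).
apply: (@Ck_eq _ _ _ _ (fun x => - 'D_v f x * ((f x)^-1 * (f x)^-1))) => //.
  move=> x Dx; rewrite deriveV; [|exact: f0|exact/diff_derivable/(Ck_diff Df)].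
  by rewrite expr2 invfM /GRing.scale/=; ring.
apply: CkM => //; first by apply: CkN => //; exact: CkS_derive.
by apply: CkM => //; apply: IH; exact: CkW.
Qed.

End RealValued.

Section Composition.
Variables (V W : normedModType R) (D : set V) (E : set W) (m : nat).
Variables (e : 'I_m -> W) (l : 'I_m -> W -> R).
Hypotheses (Do : open D) (lE : forall w, w = \sum_i l i w *: e i).

(** The chain rule differentiates [h] in the direction ['D_v f x], which varies with [x]. The finite
    frame [e] with coordinates [l] rewrites it as a combination of derivatives in fixed directions,
    to which the induction hypothesis applies. *)
Lemma Ck_comp k (f : V -> W) (h : W -> R) :
  (forall k g i, Ck k D g -> Ck k D (fun x => l i (g x))) ->
  (forall x, D x -> E (f x)) ->
  Ck k D f -> Ck k E h -> Ck k D (fun x => h (f x)).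
Proof.
move=> lk fDE; elim: k h => [|k IH] h Df Eh.
  split=> // x Dx; apply: differentiable_comp; first exact: (Ck_diff Df).
  exact/(Ck_diff Eh)/fDE.
apply/CkSP; split=> [x Dx|v].
  apply: differentiable_comp; first exact: (Ck_diff Df).
  exact/(Ck_diff Eh)/fDE.
apply: (@Ck_eq _ _ _ _ (fun x => \sum_i l i ('D_v f x) * 'D_(e i) h (f x))) => //.
  move=> x Dx.
  have df : differentiable f x by exact: (Ck_diff Df).
  have dh : differentiable h (f x) by exact/(Ck_diff Eh)/fDE.
  rewrite [RHS]deriveE; last exact: differentiable_comp.
  by rewrite diff_comp//= -deriveE// -deriveE// [in RHS](lE ('D_v f x)) derive_sumv.
apply: Ck_sum => // i; apply: CkM => //.
  by apply: lk; exact: CkS_derive.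
exact: (IH (fun w => 'D_(e i) h w) (CkW Df) (CkS_derive _ Eh)).
Qed.

End Composition.

Lemma Ck_linear k V W (D : set V) (f : {linear V -> W}) :
  continuous f -> Ck k D f.
Proof.
move=> cf; case: k => [|k]; first by split=> // x _; exact: linear_differentiable.
apply/CkSP; split=> [x _|v]; first exact: linear_differentiable.
rewrite (_ : 'D_v f = fun=> f v); first exact: Ck_cst.
apply/funext => x; rewrite deriveE; last exact: linear_differentiable.
by rewrite diff_lin.
Qed.

Section RowVectors.
Context {n : nat}.

Lemma derive_coord V (f : V -> 'rV[R]_n) x v i :
  differentiable f x -> 'D_v (fun y => f y 0 i) x = ('D_v f x) 0 i.
Proof. by move=> df; rewrite derive_mx ?mxE//; exact: diff_derivable. Qed.

Lemma Ck_coord k V (D : set V) (f : V -> 'rV[R]_n) i :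
  open D -> Ck k D f -> Ck k D (fun x => f x 0 i).
Proof.
move=> Do; elim: k f => [|k IH] f Df.
  split=> // x Dx; apply: (@differentiable_comp _ _ _ _ f (fun N : 'rV[R]_n => N 0 i)).
    exact: (Ck_diff Df).
  exact: differentiable_coord.
apply/CkSP; split=> [x Dx|v].
  apply: (@differentiable_comp _ _ _ _ f (fun N : 'rV[R]_n => N 0 i)).
    exact: (Ck_diff Df).
  exact: differentiable_coord.
apply: (@Ck_eq _ _ _ _ (fun x => ('D_v f x) 0 i)) => //.
  by move=> x Dx; rewrite derive_coord//; exact: (Ck_diff Df).
by apply: IH; exact: CkS_derive.
Qed.

Lemma row_delta_sum (w : 'rV[R]_n) : w = \sum_i w 0 i *: ebasis R i.
Proof. exact: row_sum_delta. Qed.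

Lemma Ck_comp_rV k V (D : set V) (E : set 'rV[R]_n) (f : V -> 'rV[R]_n)
    (h : 'rV[R]_n -> R) :
  open D -> (forall x, D x -> E (f x)) ->
  Ck k D f -> Ck k E h -> Ck k D (fun x => h (f x)).
Proof.
move=> Do fDE; apply: (Ck_comp Do row_delta_sum) => // k' g i.
exact: Ck_coord.
Qed.

Lemma Ck_id k V (D : set V) : Ck k D (fun x : V => x).
Proof.
case: k => [|k]; first by split=> // x _; exact: ex_diff.
apply/CkSP; split=> [x _|v]; first exact: ex_diff.
rewrite (_ : 'D_v (fun x : V => x) = fun=> v); first exact: Ck_cst.
by apply/funext => x; exact: derive_id.
Qed.

Lemma Ck_fst k (D : set ('rV[R]_n * 'rV[R]_n)) :
  Ck k D (fun p => p.1).
Proof. by apply: (Ck_linear _ _ (f := fst)) => p; exact: cvg_fst. Qed.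

Lemma Ck_snd k (D : set ('rV[R]_n * 'rV[R]_n)) :
  Ck k D (fun p => p.2).
Proof. by apply: (Ck_linear _ _ (f := snd)) => p; exact: cvg_snd. Qed.

Lemma derive_snd_coord (v p : 'rV[R]_n * 'rV[R]_n) k :
  'D_v (fun q : 'rV[R]_n * 'rV[R]_n => q.2 0 k) p = v.2 0 k.
Proof.
have d2 : differentiable (snd : 'rV[R]_n * 'rV[R]_n -> _) p.
  by apply: (Ck_diff (@Ck_snd 0 setT)).
rewrite derive_coord// deriveE// diff_lin//.
by move=> q; exact: cvg_snd.
Qed.

Lemma coords_sum (v : 'rV[R]_n * 'rV[R]_n) :
  v = \sum_k v.1 0 k *: (ebasis R k, 0) + \sum_k v.2 0 k *: (0, ebasis R k).
Proof.
rewrite [LHS]surjective_pairing [in LHS](row_delta_sum v.1) [in LHS](row_delta_sum v.2).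
have H (r : seq 'I_n) (a : 'I_n -> R) (e f : 'I_n -> 'rV[R]_n) :
    \sum_(k <- r) a k *: (e k, f k) = (\sum_(k <- r) a k *: e k, \sum_(k <- r) a k *: f k).
  elim: r => [|k r IH]; first by rewrite !big_nil.
  by rewrite !big_cons IH.
rewrite !H; congr pair => /=.
  by rewrite [X in _ + X]big1 ?addr0// => k _; rewrite scaler0.
by rewrite [X in X + _]big1 ?add0r// => k _; rewrite scaler0.
Qed.

Lemma derive_coords (F : 'rV[R]_n * 'rV[R]_n -> R) p v :
  differentiable F p ->
  'D_v F p = \sum_k v.1 0 k * dx k F p + \sum_k v.2 0 k * dy k F p.
Proof.
move=> dF; rewrite [in LHS](coords_sum v).
rewrite deriveE// linearD/= -!deriveE//.
by rewrite !derive_sumv.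
Qed.

End RowVectors.

Lemma Ck_comp_R k V (D : set V) (E : set R) (f : V -> R) (h : R -> R) :
  open D -> (forall x, D x -> E (f x)) ->
  Ck k D f -> Ck k E h -> Ck k D (fun x => h (f x)).
Proof.
move=> Do fDE.
apply: (@Ck_comp V R D E 1 (fun=> 1) (fun _ w => w)) => // w.
by rewrite big_ord1 /GRing.scale/= mulr1.
Qed.

(** * Mean value theorem along lines and symmetry of second derivatives *)

Section DirectionalMVT.
Variables (V : normedModType R).
Implicit Types (f : V -> R) (x u v : V).

Lemma is_derive_line f x v (t : R) : differentiable f (t *: v + x) ->
  is_derive t 1 (fun s : R => f (s *: v + x)) ('D_v f (t *: v + x)).
Proof.
move=> df.
have dl : is_diff t (fun s : R => s *: v + x) (fun s => s *: v).
  have -> : (fun s : R => s *: v) = (fun s : R => s *: v) + 0 by rewrite addr0.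
  exact: is_diffD.
have dfc : is_diff t (f \o (fun s : R => s *: v + x)) ('d f (t *: v + x) \o (fun s : R => s *: v)).
  by apply: is_diff_comp => //; exact: differentiableP.
apply: DeriveDef; first by apply: diff_derivable; exact: ex_diff.
rewrite deriveE; last exact: ex_diff.
by rewrite diff_val /= scale1r deriveE.
Qed.

Lemma MVT_line f x v (s : R) : 0 <= s ->
  (forall t, 0 <= t <= s -> differentiable f (t *: v + x)) ->
  exists2 t, 0 <= t <= s & f (s *: v + x) - f x = s * 'D_v f (t *: v + x).
Proof.
move=> s0 df.
have [||t] := @MVT_segment R (fun t => f (t *: v + x)) (fun t => 'D_v f (t *: v + x)) 0 s s0.
- by move=> t; rewrite in_itv/= => /andP[/ltW t0 /ltW ts]; apply: is_derive_line; apply: df; rewrite t0 ts.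
- apply: continuous_in_subspaceT => t; rewrite inE/= in_itv/= => /df dft.
  apply: differentiable_continuous; apply/derivable1_diffP.
  by have := is_derive_line dft => -[].
by rewrite in_itv/= scale0r add0r subr0 mulrC => t0s ->; exists t.
Qed.

Lemma derive_shift_arg f w x v : 'D_v (fun y => f (w + y)) x = 'D_v f (w + x).
Proof. have E : (fun h : R => h^-1 *: (((fun y => f (w + y)) \o shift x) (h *: v) - f (w + x))) =
    (fun h => h^-1 *: ((f \o shift (w + x)) (h *: v) - f (w + x))).
  by apply/funext => h /=; rewrite addrCA.
by rewrite /derive E. Qed.

Lemma differentiable_shift_arg f w x :
  differentiable f (w + x) -> differentiable (fun y => f (w + y)) x.
Proof.
move=> df; apply: (@differentiable_comp _ _ _ _ (fun y => w + y) f).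
  by [].
exact: df.
Qed.

(** The mean value theorem is used twice: along [u] for the increment [F] of [f] by [s *: v], then
    along [v] for the derivative of [f] along [u]. *)
Lemma second_difference f x u v (s : R) (D : set V) : 0 <= s -> Ck 1 D f ->
  (forall a b, 0 <= a <= s -> 0 <= b <= s -> D (a *: v + (b *: u + x))) ->
  exists a b, [/\ 0 <= a <= s, 0 <= b <= s &
    f (s *: v + (s *: u + x)) - f (s *: u + x) - (f (s *: v + x) - f x) =
    s * (s * 'D_v (fun y => 'D_u f y) (a *: v + (b *: u + x)))].
Proof.
move=> s0 Df box; have s00 : 0 <= (0:R) <= s by rewrite lexx.
have s0s : 0 <= s <= s by rewrite s0 lexx.
have box0 b : 0 <= b <= s -> D (b *: u + x).
  by move=> /(box _ _ s00); rewrite scale0r add0r.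
pose F y := f (s *: v + y) - f y.
have dF1 b : 0 <= b <= s -> differentiable (fun y => f (s *: v + y)) (b *: u + x).
  by move=> bs; apply: differentiable_shift_arg; apply: (Ck_diff Df); exact: box.
have dF2 b : 0 <= b <= s -> differentiable f (b *: u + x).
  by move=> bs; apply: (Ck_diff Df); exact: box0.
have [b bs Fb] := @MVT_line F x u s s0 (fun b bs => differentiableB (dF1 b bs) (dF2 b bs)).
have dFb : 'D_u F (b *: u + x) = 'D_u f (s *: v + (b *: u + x)) - 'D_u f (b *: u + x).
  rewrite -[F]/((fun y => f (s *: v + y)) - f) deriveB; first by rewrite derive_shift_arg.
    exact/diff_derivable/dF1.
  exact/diff_derivable/dF2.
have [|a as_ Fa] := @MVT_line (fun y => 'D_u f y) (b *: u + x) v s s0.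
  by move=> a as_; apply: (Ck_diff (CkS_derive u Df)); exact: box.
exists a, b; split=> //; move: Fb; rewrite /F dFb => ->.
by rewrite Fa.
Qed.

(** The second difference is symmetric in [u] and [v], so arbitrarily close to [x] the two mixed
    derivatives take a common value, at possibly different points. Continuity at [x], with tolerance
    half of the supposed gap, then gives the contradiction. *)
Lemma schwarz f (D : set V) x u v : open D -> Ck 2 D f -> D x ->
  'D_u (fun y => 'D_v f y) x = 'D_v (fun y => 'D_u f y) x.
Proof.
move=> Do Df Dx; apply/eqP; apply/negPn/negP => neq.
pose g1 : V -> R := fun y => 'D_u (fun y => 'D_v f y) y.
pose g2 : V -> R := fun y => 'D_v (fun y => 'D_u f y) y.
have {}neq : g1 x != g2 x by [].
have c1 : {for x, continuous g1}.
  apply: differentiable_continuous.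
  exact: (Ck_diff (CkS_derive u (CkS_derive v Df))).
have c2 : {for x, continuous g2}.
  apply: differentiable_continuous.
  exact: (Ck_diff (CkS_derive v (CkS_derive u Df))).
have g1E y : 'D_u (fun y => 'D_v f y) y = g1 y by [].
have g2E y : 'D_v (fun y => 'D_u f y) y = g2 y by [].
clearbody g1 g2.
have e0 : 0 < `|g1 x - g2 x| / 2 by rewrite divr_gt0// normr_gt0 subr_eq0.
have n1 : \forall y \near x, `|g1 x - g1 y| < `|g1 x - g2 x| / 2.
  by have /cvgrPdist_lt /(_ _ e0) := c1.
have n2 : \forall y \near x, `|g2 x - g2 y| < `|g1 x - g2 x| / 2.
  by have /cvgrPdist_lt /(_ _ e0) := c2.
have nD : \forall y \near x, D y by exact: open_nbhs_nbhs.
have /nbhs_ballP[r /= r0 rP] : \forall y \near x, [/\ D y, `|g1 x - g1 y| < `|g1 x - g2 x| / 2 &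
   `|g2 x - g2 y| < `|g1 x - g2 x| / 2].
  by near=> y; split; near: y.
(* With this size the parallelogram spanned by [s *: u] and [s *: v] at [x] stays in the ball of
   radius [r]; the summand 1 keeps the denominator positive when [u] and [v] both vanish. *)
pose s := r / (`|u| + `|v| + 1) / 2.
have d0 : 0 < `|u| + `|v| + 1 by rewrite ltr_wpDl// addr_ge0.
have s0 : 0 < s by rewrite !divr_gt0.
have inb (w w' : V) a b : `|w| + `|w'| = `|u| + `|v| -> 0 <= a <= s -> 0 <= b <= s ->
    ball x r (a *: w + (b *: w' + x)).
  move=> ww /andP[a0 as_] /andP[b0 bs].
  rewrite -ball_normE /ball_/= addrA opprD addrCA subrr addr0 normrN.
  apply: le_lt_trans (ler_normD _ _) _; rewrite !normrZ !ger0_norm//.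
  apply: (@le_lt_trans _ _ (s * (`|u| + `|v| + 1))); last first.
    by rewrite /s mulrAC divfK ?gt_eqF// ltr_pdivrMr// mulr_natr mulr2n ltrDl.
  rewrite mulrDr -ww mulrDr -addrA lerD//; first by rewrite ler_wpM2r.
  by rewrite ler_wpDr ?mulr1 ?(ltW s0)// ler_wpM2r.
have C1 : Ck 1 D f := CkW Df.
have [a1 [b1 [a1s b1s E1]]] := @second_difference f x u v s D (ltW s0) C1
  (fun a b ha hb => let: And3 h _ _ := rP _ (inb v u a b (addrC _ _) ha hb) in h).
have [a2 [b2 [a2s b2s E2]]] := @second_difference f x v u s D (ltW s0) C1
  (fun a b ha hb => let: And3 h _ _ := rP _ (inb u v a b erefl ha hb) in h).
have [_ _ h2] := rP _ (inb v u a1 b1 (addrC _ _) a1s b1s).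
have [_ h1 _] := rP _ (inb u v a2 b2 erefl a2s b2s).
have EE : g2 (a1 *: v + (b1 *: u + x)) = g1 (a2 *: u + (b2 *: v + x)).
  have sn0 : s != 0 by rewrite gt_eqF.
  rewrite g2E in E1; rewrite g1E in E2.
  have E3 : f (s *: v + (s *: u + x)) - f (s *: u + x) - (f (s *: v + x) - f x) =
      f (s *: u + (s *: v + x)) - f (s *: v + x) - (f (s *: u + x) - f x).
    by rewrite (addrCA (s *: u) (s *: v) x); ring.
  by have /(mulfI sn0)/(mulfI sn0) := etrans (esym E1) (etrans E3 E2).
rewrite EE in h2.
have : `|g1 x - g2 x| < `|g1 x - g2 x|.
  rewrite [X in _ < X]splitr -{1}(subrK (g1 (a2 *: u + (b2 *: v + x))) (g1 x)) -addrA.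
  by apply: le_lt_trans (ler_normD _ _) _; rewrite ltrD// distrC.
by rewrite ltxx.
Unshelve. all: by end_near. Qed.

Lemma derive0_const f x (r : R) : 0 < r ->
  (forall y, ball x r y -> differentiable f y) ->
  (forall y v, ball x r y -> 'D_v f y = 0) ->
  forall y, ball x r y -> f y = f x.
Proof.
move=> r0 df f0 y xy.
have seg t : 0 <= t <= 1 -> ball x r (t *: (y - x) + x).
  move=> /andP[t0 t1]; move: xy; rewrite -!ball_normE /ball_/= => xy.
  rewrite opprD addrCA subrr addr0 normrN normrZ ger0_norm//.
  by apply: le_lt_trans xy; rewrite distrC ler_piMl.
have [t t01] := @MVT_line f x (y - x) 1 ler01 (fun t t01 => df _ (seg t t01)).
have /f0 -> := seg t t01.
by rewrite scale1r subrK mulr0 => /eqP; rewrite subr_eq0 => /eqP.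
Qed.

End DirectionalMVT.

Lemma derive_exp_scale (h : R -> R) (c : R) d x v : derivable h x v ->
  'D_v (fun s => h s ^+ d * c) x = d%:R * h x ^+ d.-1 * 'D_v h x * c.
Proof.
move=> dh; have E : (fun s => h s ^+ d * c) = c *: (h ^+ d).
  have E s e : (h ^+ e) s = h s ^+ e.
    elim: e => [|e IH]; first by rewrite !expr0.
    by rewrite [in RHS]exprS -IH exprS.
  by apply/funext => s; rewrite mulrC -E.
rewrite E deriveZ; last exact: derivableX.
case: d {E} => [|d]; first by rewrite expr0 derive_cst scaler0 !mul0r.
by rewrite deriveX// /GRing.scale/= mulrC.
Qed.

(** Both sides are the derivative at [s = 0] of F(x, (1 + s) y). Homogeneity concerns positive
    factors only, so the two expressions are compared for [s] near 0. *)
Lemma euler_homog n (F : 'rV[R]_n * 'rV[R]_n -> R) (x y : 'rV[R]_n) (d : nat) :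
  differentiable F (x, y) ->
  (forall l : R, 0 < l -> F (x, l *: y) = l ^+ d * F (x, y)) ->
  \sum_k y 0 k * dy k F (x, y) = d%:R * F (x, y).
Proof.
move=> dF hF.
have D0 : 'D_(0, y) F (x, y) = \sum_k y 0 k * dy k F (x, y).
  rewrite derive_coords//= [X in X + _]big1 ?add0r// => k _.
  by rewrite mxE mul0r.
rewrite -D0.
have dF0 : differentiable F (0 *: (0, y) + (x, y)) by rewrite scale0r add0r.
have := @is_derive_line _ F (x, y) (0, y) 0 dF0.
rewrite scale0r add0r => -[_ <-].
have nearE : \forall s \near (0:R), F (s *: (0, y) + (x, y)) = (s + 1) ^+ d * F (x, y).
  near=> s.
  have s1 : 0 < s + 1.
    have : ball 0 1 s by near: s; exact: nbhsx_ballx.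
    by rewrite -ball_normE /ball_/= sub0r normrN ltr_norml => /andP[h _]; lra.
  rewrite -hF//; congr (F _); apply/pair_equal_spec; split => /=.
    by rewrite scaler0 add0r.
  by rewrite scalerDl scale1r.
rewrite (near_eq_derive _ nearE).
have dh : derivable (fun s : R => s + 1) 0 1.
  by apply: derivableD; [exact: derivable_id|exact: derivable_cst].
rewrite derive_exp_scale//.
have -> : 'D_1 (fun s : R => s + 1) 0 = 1.
  exact: (congr1 (@^~ 0) (derive_shift 1 1)).
by rewrite add0r expr1n mulr1 mulr1.
Unshelve. all: by end_near. Qed.

End SmoothCalculus.

(** * Metrics inducing a spray, in coordinates *)

Lemma derive_sum_mul (R : realType) (V : normedModType R) (m : nat)
    (a b : 'I_m -> V -> R) (p v : V) :
  (forall i, differentiable (a i) p) -> (forall i, differentiable (b i) p) ->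
  'D_v (fun q => \sum_i a i q * b i q) p =
  \sum_i ('D_v (a i) p * b i p + a i p * 'D_v (b i) p).
Proof.
move=> da db.
have E : (fun q => \sum_i a i q * b i q) = \sum_i (a i * b i).
  by apply/funext => q; rewrite fct_sumE.
have dab i : derivable (a i * b i) p v.
  by apply: derivableM; apply: diff_derivable.
rewrite E derive_sum//; apply: eq_bigr => i _.
rewrite deriveM; [|exact: diff_derivable|exact: diff_derivable].
by rewrite /GRing.scale/= addrC mulrC.
Qed.

Fact addr_sub_rearrange (R : realType) (a b c d : R) :
  a + b = c + d -> b - d = c - a.
Proof. by move=> h; lra. Qed.

Section LocalMetric.
#[local] Opaque derive.
Context {R : realType} {n : nat}.
Notation TMc := ('rV[R]_n * 'rV[R]_n)%type.
Variables (W : set TMc) (f : TMc -> R) (G : TMc -> 'rV[R]_n).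
Hypotheses (Wo : open W) (Wf : forall k, Ck k W f) (WG : forall k, Ck k W G).
Hypothesis f_homog : forall x y (l : R), 0 < l -> W (x, y) ->
  f (x, l *: y) = l ^+ 2 * f (x, y).
Hypothesis f_unit : forall p, W p -> gmx f p \in unitmx.
Hypothesis f_G : forall p, W p -> forall i : 'I_n,
  G p 0 i = 4%:R^-1 * \sum_(l < n) invmx (gmx f p) i l *
    ((\sum_(k < n) dy l (dx k f) p * p.2 0 k) - dx l f p).

Local Notation g i := (fun p => G p 0 i).
Local Notation gy i k := (dy k (fun p => G p 0 i)).

Lemma spray_coef_Ck k i : Ck k W (g i).
Proof. exact: Ck_coord. Qed.

Lemma fibre_coord_Ck k i : Ck k W (fun p => p.2 0 i).
Proof. by apply: Ck_coord => //; exact: Ck_snd. Qed.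

Lemma sum_delta (F : 'I_n -> R) l : \sum_i (i == l)%:R * F i = F l.
Proof.
rewrite (bigD1 l)//= eqxx mul1r big1 ?addr0// => i /negbTE ->.
by rewrite mul0r.
Qed.

Lemma sum_ebasis (F : 'I_n -> R) l : \sum_i ebasis R l 0 i * F i = F l.
Proof. by rewrite -[RHS]sum_delta; apply: eq_bigr => i _; rewrite mxE eqxx. Qed.

Lemma derive_y_sum (b : 'I_n -> TMc -> R) (p v : TMc) :
  (forall i, differentiable (b i) p) -> W p ->
  'D_v (fun q : TMc => \sum_i q.2 0 i * b i q) p =
  \sum_i v.2 0 i * b i p + \sum_i p.2 0 i * 'D_v (b i) p.
Proof.
move=> db Wp; rewrite derive_sum_mul//; last by move=> i; exact: (Ck_diff (fibre_coord_Ck 0 i)).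
rewrite big_split; congr (_ + _); apply: eq_bigr => i _.
by rewrite derive_snd_coord.
Qed.

Lemma metric_euler p : W p -> \sum_i p.2 0 i * dy i f p = 2%:R * f p.
Proof.
case: p => x y Wp; apply: euler_homog; first exact: (Ck_diff (Wf 0)).
by move=> l l0; exact: f_homog.
Qed.

Lemma metric_dy_diff i p : W p -> differentiable (dy i f) p.
Proof. by move=> Wp; apply: (Ck_diff (CkS_derive _ (Wf 1))). Qed.

Lemma metric_dx_diff i p : W p -> differentiable (dx i f) p.
Proof. by move=> Wp; apply: (Ck_diff (CkS_derive _ (Wf 1))). Qed.

(** Euler's identity differentiated in a constant direction [v]; the vertical and horizontal basis
    vectors turn it into the Euler identities of [dy i f], of degree one, and of [dx k f], of degree
    two. *)
Lemma metric_euler_derive (p v : TMc) : W p ->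
  \sum_i v.2 0 i * dy i f p + \sum_i p.2 0 i * 'D_v (dy i f) p = 2%:R * 'D_v f p.
Proof.
move=> Wp; rewrite -derive_y_sum//; last by move=> i; exact: metric_dy_diff.
rewrite (@near_eq_derive _ _ _ _ (2%:R *: f)).
  by rewrite deriveZ//; apply/diff_derivable/(Ck_diff (Wf 0)).
exact: open_near metric_euler.
Qed.

Lemma metric_euler_dy p l : W p -> \sum_i p.2 0 i * dy l (dy i f) p = dy l f p.
Proof.
move=> Wp; have := metric_euler_derive (0, ebasis R l) Wp.
rewrite [X in X + _ = _](_ : _ = dy l f p); last exact: (sum_ebasis (fun i => dy i f p)).
by rewrite -/(dy l f p) => H; apply: (addrI (dy l f p)); rewrite [LHS]H; ring.
Qed.

Lemma metric_euler_dx p k : W p -> \sum_i p.2 0 i * dx k (dy i f) p = 2%:R * dx k f p.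
Proof.
move=> Wp; have := metric_euler_derive (ebasis R k, 0) Wp.
by rewrite big1 ?add0r// => i _; rewrite mxE mul0r.
Qed.

Lemma metric_schwarz (u v p : TMc) : W p -> 'D_u (fun q => 'D_v f q) p = 'D_v (fun q => 'D_u f q) p.
Proof. exact: schwarz Wo (Wf 2). Qed.

Lemma dydyC i l p : W p -> dy i (dy l f) p = dy l (dy i f) p.
Proof. exact: metric_schwarz. Qed.

Lemma dydxC i l p : W p -> dy i (dx l f) p = dx l (dy i f) p.
Proof. exact: metric_schwarz. Qed.

Lemma dxDC k (w p : TMc) : W p -> dx k (fun q => 'D_w f q) p = 'D_w (dx k f) p.
Proof. exact: metric_schwarz. Qed.

Lemma dyDC k (w p : TMc) : W p -> dy k (fun q => 'D_w f q) p = 'D_w (dy k f) p.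
Proof. exact: metric_schwarz. Qed.

Lemma gmxE p i j : W p -> gmx f p i j = dy j (dy i f) p / 2%:R.
Proof.
move=> Wp; rewrite mxE /dy.
rewrite (@near_eq_derive _ _ _ _ ((2%:R^-1 : R) *: 'D_(0, ebasis R i) f)).
  rewrite deriveZ /GRing.scale/= 1?mulrC//; exact/diff_derivable/metric_dy_diff.
apply: (@open_near R _ W) => // q Wq.
have -> : (fun q => f q / 2%:R) = (2%:R^-1 : R) *: f by apply/funext => z; rewrite mulrC.
by rewrite deriveZ//; exact/diff_derivable/(Ck_diff (Wf 0)).
Qed.

(** The Euler-Lagrange equations, obtained by multiplying the spray formula by the matrix [gmx f p].
    The factor 2 is 4 divided by the 2 in the definition of [gmx]. *)
Lemma spray_eq p l : W p ->
  2%:R * \sum_i G p 0 i * dy i (dy l f) p =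
  \sum_k p.2 0 k * dy l (dx k f) p - dx l f p.
Proof.
move=> Wp; set b := fun l => (\sum_k dy l (dx k f) p * p.2 0 k) - dx l f p.
have GE i : G p 0 i = 4%:R^-1 * \sum_m invmx (gmx f p) i m * b m by exact: f_G.
transitivity (b l); last first.
  by congr (_ - _); apply: eq_bigr => k _; rewrite mulrC.
transitivity (\sum_i gmx f p l i * (\sum_m invmx (gmx f p) i m * b m)).
  rewrite mulr_sumr; apply: eq_bigr => i _; rewrite GE gmxE//.
  have h4 : 4%:R = 2%:R * 2%:R :> R by rewrite -natrM.
  by rewrite h4 invfM; field.
transitivity (\sum_i \sum_m gmx f p l i * invmx (gmx f p) i m * b m).
  by apply: eq_bigr => i _; rewrite mulr_sumr; apply: eq_bigr => m _; rewrite mulrA.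
rewrite exchange_big/= -[RHS]sum_delta; apply: eq_bigr => m _.
rewrite -mulr_suml; congr (_ * _).
have /matrixP/(_ l m) := mulmxV (f_unit Wp); rewrite !mxE eq_sym.
by [].
Qed.

(** Conservation of energy: the Euler-Lagrange equations are contracted with y^l, and Euler's
    identity collapses the second derivatives on both sides. *)
Lemma spray_kills_metric p : W p ->
  \sum_k p.2 0 k * dx k f p = 2%:R * \sum_i G p 0 i * dy i f p.
Proof.
move=> Wp.
have H : \sum_l p.2 0 l * (2%:R * \sum_i G p 0 i * dy i (dy l f) p) =
   \sum_l p.2 0 l * (\sum_k p.2 0 k * dy l (dx k f) p - dx l f p).
  by apply: eq_bigr => l _; rewrite spray_eq.
have L : \sum_l p.2 0 l * (2%:R * \sum_i G p 0 i * dy i (dy l f) p) =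
    2%:R * \sum_i G p 0 i * dy i f p.
  transitivity (\sum_l \sum_i 2%:R * (G p 0 i * (p.2 0 l * dy i (dy l f) p))).
    apply: eq_bigr => l _; rewrite mulrCA mulr_sumr mulr_sumr.
    by apply: eq_bigr => i _; ring.
  rewrite exchange_big/= mulr_sumr; apply: eq_bigr => i _.
  by rewrite -mulr_sumr -mulr_sumr metric_euler_dy.
rewrite -L H.
have -> : \sum_l p.2 0 l * (\sum_k p.2 0 k * dy l (dx k f) p - dx l f p) =
    \sum_k p.2 0 k * (\sum_l p.2 0 l * dx k (dy l f) p) - \sum_l p.2 0 l * dx l f p.
  under eq_bigr do rewrite mulrBr mulr_sumr; rewrite sumrB; congr (_ - _).
  rewrite exchange_big/=; apply: eq_bigr => k _.
  rewrite mulr_sumr; apply: eq_bigr => l _; rewrite mulrCA.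
  by rewrite dydxC.
under [X in _ = X - _]eq_bigr do rewrite metric_euler_dx// mulrCA.
by rewrite -mulr_sumr; ring.
Qed.

Lemma spray_coef_diff i p : W p -> differentiable (g i) p.
Proof. by move=> Wp; exact: (Ck_diff (spray_coef_Ck 0 i)). Qed.

Lemma spray_kills_derive (p v : TMc) : W p ->
  \sum_k v.2 0 k * dx k f p + \sum_k p.2 0 k * 'D_v (dx k f) p =
  2%:R * (\sum_i ('D_v (g i) p * dy i f p + G p 0 i * 'D_v (dy i f) p)).
Proof.
move=> Wp; rewrite -derive_y_sum//; last by move=> i; exact: metric_dx_diff.
rewrite -derive_sum_mul; last 2 first.
- by move=> i; exact: spray_coef_diff.
- by move=> i; exact: metric_dy_diff.
have E : \forall q \near p, (fun q : TMc => \sum_k q.2 0 k * dx k f q) q = (2%:R *: (fun q => \sum_i G q 0 i * dy i f q)) q.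
  exact: open_near spray_kills_metric.
rewrite (near_eq_derive _ E) deriveZ//; apply: diff_derivable.
apply: (@Ck_diff _ 0 _ _ W) => //; apply: Ck_sum => // i; apply: CkM => //; first exact: spray_coef_Ck.
exact: CkS_derive _ (Wf 1).
Qed.

(** Energy conservation is differentiated along y^l; its second-order terms are those of the
    Euler-Lagrange equations, and eliminating them leaves twice the claim. *)
Lemma horizontal_metric p l : W p -> dx l f p = \sum_i gy i l p * dy i f p.
Proof.
move=> Wp; have := spray_kills_derive (0, ebasis R l) Wp.
rewrite [X in X + _ = _](_ : _ = dx l f p); last exact: (sum_ebasis (fun k => dx k f p)).
rewrite big_split mulrDr /= -/(dy l _).
have -> : 2%:R * (\sum_i G p 0 i * 'D_(0, ebasis R l) (dy i f) p) =
   2%:R * \sum_i G p 0 i * dy i (dy l f) p.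
  apply: (congr1 ( *%R _)); apply: eq_bigr => i _.
  exact: (congr1 ( *%R _) (dydyC l i Wp)).
rewrite spray_eq// => H.
have {}H : 2%:R * dx l f p = 2%:R * \sum_i gy i l p * dy i f p.
  have H' : dx l f p + \sum_k p.2 0 k * dy l (dx k f) p =
     2%:R * (\sum_i gy i l p * dy i f p) + (\sum_k p.2 0 k * dy l (dx k f) p - dx l f p) by exact: H.
  by move: H'; rewrite addrA => /eqP; rewrite -subr_eq => /eqP H'; lra.
by apply: (mulfI _ H); rewrite pnatr_eq0.
Qed.

(* The direction v = (y, -2G) of the spray is frozen at p, so that D_v commutes
   with every D_w; this replaces the Lie bracket [spray, horizontal field]. *)
Lemma derive_along_spray p (w : TMc) : W p ->
  'D_w (fun q => 'D_(p.2, - (2%:R *: G p)) f q) p =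
  2%:R * (\sum_i 'D_w (g i) p * dy i f p) - \sum_k w.2 0 k * dx k f p.
Proof.
move=> Wp; rewrite metric_schwarz// derive_coords; last exact: (Ck_diff (CkS_derive _ (Wf 1))).
have := spray_kills_derive w Wp; rewrite big_split/= mulrDr => H.
have Ex : \sum_k p.2 0 k * dx k ('D_w f) p = \sum_k p.2 0 k * 'D_w (dx k f) p.
  by apply: eq_bigr => k _; exact: (congr1 ( *%R _) (dxDC k w Wp)).
have Ey : \sum_k (- (2%:R *: G p)) 0 k * dy k ('D_w f) p =
   - (2%:R * \sum_k G p 0 k * 'D_w (dy k f) p).
  rewrite mulr_sumr -sumrN; apply: eq_bigr => k _.
  by rewrite (dyDC k w Wp) !mxE mulNr mulrA.
rewrite [LHS](congr2 +%R Ex Ey).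
exact: addr_sub_rearrange H.
Qed.

Lemma derive_horizontal p (v : TMc) k : W p ->
  'D_v (dx k f) p = \sum_i ('D_v (gy i k) p * dy i f p + gy i k p * 'D_v (dy i f) p).
Proof.
move=> Wp; rewrite -derive_sum_mul; last 2 first.
- by move=> i; apply: (Ck_diff (CkS_derive _ (spray_coef_Ck 1 i))).
- by move=> i; exact: metric_dy_diff.
apply: near_eq_derive.
exact: (open_near Wo Wp (fun q Wq => horizontal_metric k Wq)).
Qed.

(** Convertible to [riemann], but stated for a bare coefficient map [G], so that the computation
    takes place in an open set of coordinates without any manifold. *)
Definition spray_riemann (i k : 'I_n) (p : TMc) : R :=
  2%:R * dx k (g i) p
  - \sum_(j < n) p.2 0 j * dx j (gy i k) p
  + 2%:R * (\sum_(j < n) G p 0 j * dy k (gy i j) p)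
  - \sum_(j < n) gy i j p * gy j k p.

Lemma riemann_kills_metric p k : W p ->
  \sum_i spray_riemann i k p * dy i f p = 0.
Proof.
move=> Wp; set v : TMc := (p.2, - (2%:R *: G p)).
have H1 : 'D_v (dx k f) p = 2%:R * (\sum_i dx k (g i) p * dy i f p).
  rewrite -(dxDC k v Wp) [LHS](derive_along_spray (ebasis R k, 0) Wp) [X in _ - X]big1 ?subr0// => i _.
  by rewrite mxE mul0r.
have H2 i : 'D_v (dy i f) p = \sum_m gy m i p * dy m f p.
  rewrite -(dyDC i v Wp) [LHS](derive_along_spray (0, ebasis R i) Wp).
  rewrite [X in _ - X](_ : _ = dx i f p); last exact: (sum_ebasis (fun k => dx k f p)).
  by rewrite (horizontal_metric i Wp) mulr_natl mulr2n -addrA subrr addr0.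
have H3 i : 'D_v (gy i k) p =
    \sum_j p.2 0 j * dx j (gy i k) p - 2%:R * \sum_j G p 0 j * dy k (gy i j) p.
  rewrite derive_coords; last exact: (Ck_diff (CkS_derive _ (spray_coef_Ck 1 i))).
  congr (_ + _); rewrite mulr_sumr -sumrN; apply: eq_bigr => j _.
  rewrite mulrA -mulNr.
  have -> : v.2 0 j = - (2%:R * G p 0 j) by rewrite !mxE.
  exact: (congr1 ( *%R _) (schwarz (0, ebasis R j) (0, ebasis R k) Wo (spray_coef_Ck 2 i) Wp)).
have := derive_horizontal v k Wp; rewrite H1 big_split/= => H.
have H4 : \sum_i gy i k p * 'D_v (dy i f) p = \sum_i (\sum_j gy i j p * gy j k p) * dy i f p.
  under eq_bigr do rewrite H2 mulr_sumr.
  rewrite exchange_big/=; apply: eq_bigr => i _; rewrite mulr_suml; apply: eq_bigr => j _.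
  by rewrite mulrA [X in X * _ = _]mulrC.
rewrite H4 in H.
transitivity (2%:R * (\sum_i dx k (g i) p * dy i f p) -
  (\sum_i 'D_v (gy i k) p * dy i f p + \sum_i (\sum_j gy i j p * gy j k p) * dy i f p)).
  rewrite mulr_sumr -big_split -sumrB; apply: eq_bigr => i _; rewrite H3 /spray_riemann.
  have gen (a b c d e : R) : (2%:R * a - b + 2%:R * c - d) * e =
    2%:R * (a * e) - ((b - 2%:R * c) * e + d * e) by ring.
  exact: gen.
by rewrite H subrr.
Qed.

Lemma scalar_riemann_metric p (S : R) (tau : 'I_n -> R) k : W p ->
  (forall i k, spray_riemann i k p = S * (i == k)%:R - tau k * p.2 0 i) ->
  S * dy k f p = 2%:R * tau k * f p.
Proof.
move=> Wp HS; have := riemann_kills_metric k Wp.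
under eq_bigr do rewrite HS mulrBl.
rewrite sumrB => /eqP; rewrite subr_eq0 => /eqP H.
have E1 : \sum_i S * (i == k)%:R * dy i f p = S * dy k f p.
  rewrite -(sum_delta (fun i => dy i f p) k) mulr_sumr.
  by apply: eq_bigr => i _; rewrite mulrA.
have E2 : \sum_i tau k * p.2 0 i * dy i f p = 2%:R * tau k * f p.
  under eq_bigr do rewrite -mulrA; rewrite -mulr_sumr metric_euler//.
  by rewrite mulrCA mulrA.
by rewrite -E1 H E2.
Qed.

(** A nowhere zero metric turns [S = 0] into [tau = 0], and then the whole curvature vanishes. This
    converts the hypothesis on Ric into one on the factor [S], by which one has to divide. *)
Lemma scalar_riemann_ricci p (S : R) (tau : 'I_n -> R) : W p -> f p != 0 ->
  (forall i k, spray_riemann i k p = S * (i == k)%:R - tau k * p.2 0 i) ->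
  S = 0 -> \sum_i spray_riemann i i p = 0.
Proof.
move=> Wp fp HS S0.
have t0 k : tau k = 0.
  have := scalar_riemann_metric k Wp HS; rewrite S0 mul0r => /esym/eqP.
  by rewrite !mulf_eq0 pnatr_eq0 (negbTE fp) orbF/= => /eqP.
by apply: big1 => i _; rewrite HS S0 t0 !mul0r subrr.
Qed.

End LocalMetric.

(** * Null sets have empty interior *)

Lemma ball_rV (R : realType) n (x y : 'rV[R]_n) (r : R) : 0 < r ->
  ball x r y <-> forall j, ball (x 0 j) r (y 0 j).
Proof.
move=> r0; split; first by move=> [_ h] j; exact: h.
by move=> h; split=> // i j; rewrite ord1; exact: h.
Qed.

Lemma ball_pair (R : realType) (V W : normedModType R) (x y : V * W) (r : R) :
  ball x r y <-> ball x.1 r y.1 /\ ball x.2 r y.2.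
Proof. by split. Qed.

(** All such indices lie between the least one [i] and the greatest one [j], and [be * (j - i)] is
    less than the diameter [2 r]. *)
Lemma card_ord_near (R : realType) (N : nat) (al be a r : R) : 0 < be -> 0 < r ->
  #|[set i : 'I_N | `|a - (al + be * i%:R)| < r]%SET|%:R <= 2%:R * r / be + 1 :> R.
Proof.
move=> be0 r0; set S := finset _.
have [->|[i0 i0S]] := set_0Vmem S.
  by rewrite cards0 addr_ge0// mulr_ge0 ?invr_ge0 ?(ltW be0)// mulr_ge0// ltW.
have [i i_S imin] := @arg_minnP _ i0 [in S] (fun i : 'I_N => i : nat) i0S.
have [j j_S jmax] := @arg_maxnP _ i0 [in S] (fun i : 'I_N => i : nat) i0S.
have ij : (i <= j)%N by exact: imin.
have cS : (#|S| <= (j - i).+1)%N.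
  rewrite -[X in (_ <= X)%N]card_ord.
  rewrite -(@card_in_imset _ _ (fun k : 'I_N => inord (k - i) : 'I_(j - i).+1)).
    exact: max_card.
  move=> k l kS lS /(congr1 (@nat_of_ord _)).
  have ki : (i <= k)%N by exact: imin.
  have li : (i <= l)%N by exact: imin.
  rewrite !inordK ?ltnS ?leq_sub2r//; try exact: jmax.
  move=> H; apply: val_inj => /=; by rewrite -(subnK ki) H subnK.
apply: (@le_trans _ _ ((j - i).+1)%:R); first by rewrite ler_nat.
rewrite -natr1 lerD2r natrB// ler_pdivlMr// mulrC.
move: i_S j_S; rewrite !inE !ltr_norml => /andP[h1 h2] /andP[h3 h4].
rewrite mulrBr; move: h1 h2 h3 h4.
set x := be * i%:R; set y := be * j%:R; move=> *; lra.
Qed.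

Section GridCount.
Context {R : realType} {n : nat}.
Notation TMc := ('rV[R]_n * 'rV[R]_n)%type.

Definition grid (p : TMc) (h : R) (N : nat) (g : {ffun 'I_n + 'I_n -> 'I_N}) : TMc :=
  (\row_j (p.1 0 j - h + 2%:R * h / N%:R * (g (inl j))%:R),
   \row_j (p.2 0 j - h + 2%:R * h / N%:R * (g (inr j))%:R)).

(** A sup-norm ball constrains the 2n coordinates independently, so the count is bounded by a
    product of one-dimensional counts with step 2h/N. *)
Lemma card_grid_ball p h N (a : TMc) r : 0 < h -> 0 < r -> (0 < N)%N ->
  #|[set g | `[< ball a r (@grid p h N g) >]]%SET|%:R <= (r * N%:R / h + 1) ^+ (2 * n) :> R.
Proof.
move=> h0 r0 N0.
pose x (s : 'I_n + 'I_n) := match s with inl j => p.1 0 j | inr j => p.2 0 j end.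
pose b (s : 'I_n + 'I_n) := match s with inl j => a.1 0 j | inr j => a.2 0 j end.
pose be : R := 2%:R * h / N%:R.
have be0 : 0 < be by rewrite divr_gt0 ?mulr_gt0 ?ltr0n.
pose F (s : 'I_n + 'I_n) := [set i : 'I_N | `|b s - (x s - h + be * i%:R)| < r]%SET.
pose y0 := Ordinal N0.
have sub : [set g | `[< ball a r (@grid p h N g) >]]%SET \subset pfamily y0 xpredT (fun s => [in F s]).
  apply/fintype.subsetP => g; rewrite inE => /asboolP /ball_pair[/(ball_rV _ _ r0) h1 /(ball_rV _ _ r0) h2].
  apply/pfamilyP; split; first by apply/fintype.subsetP.
  move=> -[] j _; rewrite !inE.
    by have := h1 j; rewrite -ball_normE /ball_/= mxE.
  by have := h2 j; rewrite -ball_normE /ball_/= mxE.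
apply: (@le_trans _ _ #|pfamily y0 xpredT (fun s => [in F s])|%:R).
  by rewrite ler_nat; exact: subset_leq_card.
rewrite card_pfamily foldrE big_map big_enum/= natr_prod.
apply: (@le_trans _ _ (\prod_(s : 'I_n + 'I_n) (r * N%:R / h + 1))); last first.
  by rewrite prodr_const card_sum card_ord addnn -mul2n.
apply: ler_prod => s _; rewrite ler0n/=.
apply: le_trans (card_ord_near _ _ _ be0 r0) _.
rewrite lerD2r /be; have N0' : N%:R != 0 :> R by rewrite pnatr_eq0 -lt0n.
have hn : h != 0 by rewrite gt_eqF.
rewrite le_eqVlt; apply/orP; left; apply/eqP; by field; rewrite N0' hn.
Qed.

Lemma grid_cube (p : TMc) (h : R) N (g : {ffun 'I_n + 'I_n -> 'I_N}) : 0 < h ->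
  (forall j, p.1 0 j - h <= (grid p h g).1 0 j <= p.1 0 j + h) /\
  (forall j, p.2 0 j - h <= (grid p h g).2 0 j <= p.2 0 j + h).
Proof.
move=> h0; have H (x : R) (i : 'I_N) : x - h <= x - h + 2%:R * h / N%:R * i%:R <= x + h.
  have N0 : 0 < N%:R :> R by rewrite ltr0n (leq_ltn_trans _ (ltn_ord i)).
  rewrite lerDl mulr_ge0 ?divr_ge0 ?mulr_ge0 ?(ltW h0) ?(ltW N0)//=.
  have : N%:R^-1 * i%:R <= 1 :> R by rewrite ler_pdivrMl// mulr1 ler_nat ltnW.
  move=> /(ler_wpM2l (mulr_ge0 (ler0n R 2) (ltW h0))); rewrite mulrA mulr1.
  by set z := _ * i%:R => hz; lra.
by split=> j; rewrite mxE.
Qed.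

Lemma cube_compact (p : TMc) (h : R) :
  compact [set q : TMc | (forall j, p.1 0 j - h <= q.1 0 j <= p.1 0 j + h) /\
                   (forall j, p.2 0 j - h <= q.2 0 j <= p.2 0 j + h)].
Proof.
have C (x : 'rV[R]_n) : compact [set v : 'rV[R]_n | forall j, `[x 0 j - h, x 0 j + h]%classic (v 0 j)].
  by apply: (@rV_compact R n (fun j => `[x 0 j - h, x 0 j + h]%classic)) => j; exact: segment_compact.
rewrite (_ : mkset _ = [set v : 'rV[R]_n | forall j, `[p.1 0 j - h, p.1 0 j + h]%classic (v 0 j)] `*`
   [set v : 'rV[R]_n | forall j, `[p.2 0 j - h, p.2 0 j + h]%classic (v 0 j)]).
  exact: compact_setX.
by apply/seteqP; split=> q [h1 h2]; split=> j; have := h1 j; have := h2 j; rewrite /= ?in_itv.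
Qed.

(* A cube of side 2h contains N^(2n) points of a grid of step 2h/N, a cube of
   radius r at most (rN/h + 1)^(2n) of them; compactness leaves finitely many
   covering cubes, and N is then chosen so that 1 <= rN/h for each of them. *)
Lemma null_set_not_open (N D : set TMc) p :
  Defs.null_set N -> open D -> D p -> D `<=` N -> False.
Proof.
move=> nullN Do Dp DN.
have /nbhs_ballP[s /= s0 sD] : nbhs p D by exact: open_nbhs_nbhs.
pose h := s / 2%:R; have h0 : 0 < h by rewrite divr_gt0.
have hs : h < s by rewrite ltr_pdivrMr// mulr_natr mulr2n ltrDl.
pose K := [set q : TMc | (forall j, p.1 0 j - h <= q.1 0 j <= p.1 0 j + h) /\
                   (forall j, p.2 0 j - h <= q.2 0 j <= p.2 0 j + h)].
have KN : K `<=` N.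
  move=> q [q1 q2]; apply: DN; apply: sD; apply/ball_pair; split; apply/ball_rV => // j.
    have := q1 j; rewrite -ball_normE /ball_/= ltr_norml => /andP[*]; apply/andP; split; lra.
  have := q2 j; rewrite -ball_normE /ball_/= ltr_norml => /andP[*]; apply/andP; split; lra.
(* The grid count below forces the covering cubes to have total volume at least [h ^+ (2 * n)]; half
   of that is a contradictory bound. *)
have e0 : 0 < h ^+ (2 * n) / 2%:R by rewrite divr_gt0// exprn_gt0.
have [a [r [r0 Nb sum_le]]] := nullN _ e0.
have cK : compact K by exact: cube_compact.
have [k0 _ Kk0] : \forall k \near \oo, K `<=` (fun q => exists j : 'I_k, ball (a j) (r j) q).
  move/compact_near_coveringP : cK => /(_ nat \oo (fun k q => exists j : 'I_k, ball (a j) (r j) q)).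
  apply=> q Kq; have [k _ qk] := Nb _ (KN _ Kq).
  exists (ball (a k) (r k), [set m | (k < m)%N]).
    by split; [exact: open_nbhs_nbhs (conj (ball_open _ _) qk)|exact: nbhs_infty_gt].
  by move=> [q' m] [/= q'k km]; exists (Ordinal km).
have {Kk0} KJ' q : K q -> exists k : 'I_k0, ball (a k) (r k) q by move=> /(Kk0 k0 (leqnn _)).
have [N0 N0P] : exists N0 : nat, (0 < N0)%N /\ forall k : 'I_k0, h <= r k * N0%:R.
  pose m (k : 'I_k0) := Num.Def.archi_bound (h / r k).
  exists (\max_(k < k0) m k).+1; split=> // k.
  have : h / r k < (m k)%:R by apply: archi_boundP; rewrite divr_ge0 ?(ltW h0) ?(ltW (r0 _)).
  rewrite ltr_pdivrMr// mulrC => /ltW /le_trans; apply.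
  by rewrite ler_pM2l// ler_nat; apply: leq_trans (leqnSn _); exact: leq_bigmax.
case: N0P => N0_gt0 N0P.
pose S (k : 'I_k0) := [set g | `[< ball (a k) (r k) (@grid p h N0 g) >]]%SET.
have cover_grid : (#|{: {ffun 'I_n + 'I_n -> 'I_N0}}| <= \sum_(k < k0) #|S k|)%N.
  rewrite -sum1_card.
  apply: (@leq_trans (\sum_(g : {ffun 'I_n + 'I_n -> 'I_N0}) \sum_(k < k0) (g \in S k))%N).
    apply: leq_sum => g _; have [k kb] := KJ' (grid p h g) (grid_cube p g h0).
    rewrite (bigD1 k)//= inE; have -> : `[< ball (a k) (r k) (grid p h g) >] by apply/asboolP.
    exact: leq_addr.
  rewrite exchange_big/=; apply: leq_sum => k _.
  rewrite -[X in (_ <= X)%N]sum1_card [X in (_ <= X)%N]big_mkcond/=.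
  by apply: leq_sum => g _; case: (g \in S k).
have cnt : (N0%:R ^+ (2 * n) : R) <= \sum_(k < k0) (r k * N0%:R / h + 1) ^+ (2 * n).
  rewrite -natrX; apply: (@le_trans _ _ (\sum_(k < k0) #|S k|)%:R).
    by rewrite ler_nat; move: cover_grid; rewrite card_ffun card_sum !card_ord addnn -mul2n.
  rewrite natr_sum; apply: ler_sum => k _; exact: card_grid_ball.
have hn : 0 < h ^+ (2 * n) by rewrite exprn_gt0.
have Np : 0 < N0%:R ^+ (2 * n) :> R by rewrite exprn_gt0// ltr0n.
have cnt2 : h ^+ (2 * n) <= \sum_(k < k0) (2%:R * r k) ^+ (2 * n).
  rewrite -(ler_pM2l Np) mulr_sumr mulrC -ler_pdivlMl//.
  apply: le_trans cnt _; rewrite mulr_sumr; apply: ler_sum => k _.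
  rewrite -exprMn -exprVn -exprMn; apply: lerXn2r; rewrite ?nnegrE.
  - by rewrite addr_ge0// divr_ge0 ?(ltW h0)// mulr_ge0 ?(ltW (r0 _)).
  - by rewrite mulr_ge0 ?invr_ge0 ?(ltW h0)// mulr_ge0// mulr_ge0 ?(ltW (r0 _)).
  have := N0P k => H; have H1 : 1 <= r k * N0%:R / h by rewrite ler_pdivlMr// mul1r.
  have -> : h^-1 * (N0%:R * (2%:R * r k)) = r k * N0%:R / h + r k * N0%:R / h by ring.
  by rewrite lerD2l.
have le2 : \sum_(k < k0) (2%:R * r k) ^+ (2 * n) <= h ^+ (2 * n) / 2%:R.
  rewrite -lee_fin -sumEFin; apply: le_trans sum_le.
  rewrite -(big_mkord xpredT (fun k => ((2%:R * r k) ^+ (2 * n))%:E)).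
  apply: nneseries_lim_ge => k _ _; rewrite lee_fin exprn_ge0// mulr_ge0// ltW//.
have := le_trans cnt2 le2; rewrite ler_pdivlMr// mulr_natr mulr2n -[X in _ <= X]addr0 lerD2l.
by rewrite leNgt hn.
Qed.

End GridCount.

(** * Continuation of germs over convex sets *)

(** Since the step passes between any two parameters close to [s], one jump leads from a parameter
    near the supremum of [P] to one beyond it, unless 1 is reached; [P] at the supremum itself is
    not examined. *)
Lemma real_induction01 (R : realType) (P : R -> Prop) : P 0 ->
  (forall s, 0 <= s <= 1 -> exists2 e, 0 < e & forall t t',
     0 <= t <= 1 -> 0 <= t' <= 1 -> `|t - s| < e -> `|t' - s| < e -> P t -> P t') ->
  P 1.
Proof.
move=> P0 step.
pose T := [set t : R | 0 <= t <= 1 /\ P t].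
have T0 : T 0 by split=> //; rewrite lexx ler01.
have supT : has_sup T by split; [exists 0|exists 1 => t [/andP[]]].
have ubT : ubound T (sup T) := ub_le_sup (proj2 supT).
have s0 : 0 <= sup T by exact: ubT.
have s1 : sup T <= 1 by apply: ge_sup; [exists 0|move=> t [/andP[]]].
have [|e e0 He] := step (sup T); first by rewrite s0.
have [t [t01 Pt] ts] := sup_adherent e0 supT.
have tle : t <= sup T by apply: ubT.
pose t' := Num.min 1 (sup T + e / 2).
have e2 : 0 < e / 2 by rewrite divr_gt0.
have e2e : e / 2 < e by rewrite ltr_pdivrMr// mulr_natr mulr2n ltrDl.
have t'01 : 0 <= t' <= 1.
  by rewrite ge_min lexx/= le_min ler01/= addr_ge0// ltW.
have st' : sup T <= t' by rewrite le_min s1/= lerDl ltW.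
have Pt' : P t'.
  apply: (He t) => //.
    by rewrite ltr_distlC; apply/andP; split; lra.
  rewrite ger0_norm ?subr_ge0// ltrBlDl; apply: le_lt_trans (_ : sup T + e / 2 < _).
    by rewrite ge_min lexx orbT.
  by rewrite ltrD2l.
have t's : t' <= sup T by apply: ubT.
have : t' = 1.
  move: t's; rewrite /t' ge_min => /orP[h|h]; last by lra.
  by apply/min_idPl; lra.
by move=> <-.
Qed.

Section Continuation.
Context {R : realType} {V : normedModType R}.

Definition convex_in (D : set V) :=
  forall x y (t : R), D x -> D y -> 0 <= t <= 1 -> D (t *: (y - x) + x).

Lemma segment_near (x y : V) (s r : R) : 0 < r ->
  exists2 e, 0 < e & forall t : R, `|t - s| < e ->
    ball (s *: (y - x) + x) r (t *: (y - x) + x).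
Proof.
move=> r0; have d0 : 0 < `|y - x| + 1 by rewrite ltr_wpDl.
exists (r / (`|y - x| + 1)); first by rewrite divr_gt0.
move=> t ts; rewrite -ball_normE /ball_/= opprD addrACA subrr addr0 -scalerBl.
rewrite normrZ distrC; apply: (@le_lt_trans _ _ (`|t - s| * (`|y - x| + 1))).
  by rewrite ler_wpM2l// lerDl.
by rewrite -ltr_pdivlMr.
Qed.

Lemma lerp_sub (a1 a2 z1 z2 : V) (s : R) :
  s *: (a2 - a1) + a1 - (s *: (z2 - z1) + z1) = s *: (a2 - z2) + (1 - s) *: (a1 - z1).
Proof.
rewrite [RHS](_ : _ = s *: ((a2 - z2) - (a1 - z1)) + (a1 - z1)); last first.
  rewrite scalerBl scale1r (scalerBr s (a2 - z2)) addrCA; exact: addrC.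
have -> : (a2 - z2) - (a1 - z1) = (a2 - a1) - (z2 - z1).
  by rewrite (opprD a1) (opprD z2); exact: addrACA.
rewrite (scalerBr s (a2 - a1)) opprD; exact: addrACA.
Qed.

Lemma locally_constant_convex (T : Type) (D : set V) (f : V -> T) :
  convex_in D -> (forall x, D x -> \forall y \near x, f y = f x) ->
  forall x y, D x -> D y -> f y = f x.
Proof.
move=> cD lf x y Dx Dy.
have := @real_induction01 R (fun t => f (t *: (y - x) + x) = f x).
rewrite scale1r subrK; apply; first by rewrite scale0r add0r.
move=> s s01; have /lf/nbhs_ballP[r /= r0 rf] := cD _ _ _ Dx Dy s01.
have [e e0 He] := segment_near x y s r0.
by exists e => // t t' _ _ /He/rf -> /He/rf ->.
Qed.

(** [P x f] says that the germ of [f] at [x] is a section of a sheaf; the hypotheses make this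
    sheaf, where it has sections, a torsor under the locally constant real functions. *)
Variable P : V -> (V -> R) -> Prop.
Hypothesis P_ext : forall x f g, P x f -> (\forall y \near x, f y = g y) -> P x g.
Hypothesis P_uniq : forall x f g, P x f -> P x g ->
  exists c, \forall y \near x, f y = g y + c.
Hypothesis P_shift : forall x f c, P x f -> P x (fun y => f y + c).
Hypothesis P_open : forall x f, P x f -> \forall y \near x, P y f.

Lemma germ_uniq_convex (D : set V) f g : convex_in D ->
  (forall x, D x -> P x f) -> (forall x, D x -> P x g) ->
  exists c, forall x, D x -> f x = g x + c.
Proof.
move=> cD Df Dg.
have [[x0 Dx0]|D0] := pselect (exists x, D x); last first.
  by exists 0 => x Dx; exfalso; apply: D0; exists x.
have H : forall x y, D x -> D y -> (f \- g) y = (f \- g) x.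
  apply: locally_constant_convex => // x Dx.
  have [c fg] := P_uniq (Df _ Dx) (Dg _ Dx).
  near=> y; rewrite /= (near fg y)// (nbhs_singleton fg) addrAC subrr add0r addrAC subrr add0r//.
exists (f x0 - g x0) => x Dx; have /= <- := H _ _ Dx0 Dx.
by rewrite addrC subrK.
Unshelve. all: by end_near. Qed.

Definition tube (o y : V) (t e : R) : set V :=
  [set z | exists2 u, 0 <= u <= t & ball (u *: (y - o) + o) e z].

Lemma tube_convex o y t e : convex_in (tube o y t e).
Proof.
move=> z1 z2 s [u1 /andP[u10 u1t] b1] [u2 /andP[u20 u2t] b2] /andP[s0 s1].
exists (s * (u2 - u1) + u1).
  have -> : s * (u2 - u1) + u1 = s * u2 + (1 - s) * u1 by ring.
  apply/andP; split; first by rewrite addr_ge0// mulr_ge0// subr_ge0.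
  have -> : t = s * t + (1 - s) * t by ring.
  by rewrite lerD// ler_wpM2l// subr_ge0.
move: b1 b2; rewrite -ball_normE /ball_/= => b1 b2.
have -> : (s * (u2 - u1) + u1) *: (y - o) + o - (s *: (z2 - z1) + z1) =
    s *: (u2 *: (y - o) + o - z2) + (1 - s) *: (u1 *: (y - o) + o - z1).
  set d := y - o; set a1 := u1 *: d + o; set a2 := u2 *: d + o.
  have -> : (s * (u2 - u1) + u1) *: d + o = s *: (a2 - a1) + a1.
    rewrite /a2 /a1 opprD addrACA subrr addr0 -scalerBl scalerDl -scalerA -addrA.
    by [].
  exact: lerp_sub.
apply: le_lt_trans (ler_normD _ _) _; rewrite !normrZ !ger0_norm ?subr_ge0//.
have -> : e = s * e + (1 - s) * e by ring.
have [->|sn0] := eqVneq s 0; first by rewrite !mul0r !add0r subr0 !mul1r.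
by apply: ltr_leD; [rewrite ltr_pM2l// lt_def sn0|rewrite ler_wpM2l ?subr_ge0// ltW].
Qed.

Lemma tube_near o y t e z : tube o y t e z -> \forall w \near z, tube o y t e w.
Proof.
move=> [u ut b]; have : \forall w \near z, ball (u *: (y - o) + o) e w.
  exact: open_nbhs_nbhs (conj (ball_open _ _) b).
by apply: filterS => w bw; exists u.
Qed.

Lemma ball_convex (x : V) (r : R) : convex_in (ball x r).
Proof.
move=> z1 z2 s b1 b2 s01.
have tubeE z : tube x x 0 r z <-> ball x r z.
  split=> [[u _]|]; first by rewrite subrr scaler0 add0r.
  by exists 0; rewrite ?lexx// subrr scaler0 add0r.
by apply/tubeE; apply: tube_convex => //; exact/tubeE.
Qed.

(* Continuation of a germ along the segment [o, y], by real induction on the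
   length of the part of the segment already covered by a tube. *)
Lemma tube_germ (D : set V) o y : convex_in D -> D o -> D y ->
  (forall x, D x -> exists f, P x f) ->
  exists e f, 0 < e /\ forall z, tube o y 1 e z -> P z f.
Proof.
move=> cD Do Dy ex.
apply: (@real_induction01 R (fun t => exists e f, 0 < e /\ forall z, tube o y t e z -> P z f)).
  have [f Pf] := ex _ Do; have /nbhs_ballP[e /= e0 ef] := P_open Pf.
  exists e, f; split=> // z [u u0 bz]; apply: ef; move: bz.
  have -> : u = 0 by apply/eqP; rewrite eq_le andbC.
  by rewrite scale0r add0r.
move=> s s01; have [h Ph] := ex _ (cD _ _ _ Do Dy s01).
have /nbhs_ballP[r /= r0 rh] := P_open Ph.
have r2 : 0 < r / 2 by rewrite divr_gt0.
have [e0 e00 He0] := segment_near o y s r2.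
exists e0 => // t t' t01 t'01 ts t's [e [f [e_gt0 Hf]]].
pose e' := Num.min e (r / 2).
have e'0 : 0 < e' by rewrite lt_min e_gt0.
have sub : tube o y t e' `<=` tube o y t e.
  by move=> z [u ut b]; exists u => //; apply: le_ball b; rewrite ge_min lexx.
(* The germ [h] lives on [B]. The old tube was narrowed to [r / 2] so that the part to be added lies
   in [B], the other [r / 2] being spent on the distance from [s]. *)
pose B := ball (s *: (y - o) + o) r.
have [|||c Hc] := @germ_uniq_convex (tube o y t e' `&` B) f h.
- move=> z1 z2 a [T1 B1] [T2 B2] a01; split; [exact: tube_convex|exact: ball_convex].
- by move=> z [/sub /Hf].
- by move=> z [_ /rh].
(* The constant [c] makes both branches agree on the convex overlap of the tube with [B], so the
   case distinction creates no jump. *)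
pose F z := if `[< tube o y t e' z >] then f z else h z + c.
exists e', F; split=> // z [u /andP[u0 ut'] b].
have [Tz|nTz] := pselect (tube o y t e' z).
  apply: P_ext (Hf _ (sub _ Tz)) _; near=> w.
  have Tw : tube o y t e' w by near: w; exact: tube_near.
  by rewrite /F; move/asboolP : Tw => ->.
have tu : t < u.
  by rewrite ltNge; apply/negP => ut; apply: nTz; exists u; rewrite ?u0.
have Bz : B z.
  have us : `|u - s| < e0.
    move: ts t's; rewrite !ltr_norml => /andP[h1 h2] /andP[h3 h4].
    by apply/andP; split; lra.
  rewrite /B (splitr r); apply: ball_triangle (He0 _ us) _.
  by apply: le_ball b; rewrite ge_min lexx orbT.
apply: P_ext (P_shift c (rh _ Bz)) _; near=> w.
have Bw : B w by near: w; exact: open_nbhs_nbhs (conj (ball_open _ _) Bz).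
rewrite /F; case: asboolP => // Tw; by rewrite Hc.
Unshelve. all: by end_near. Qed.

(** The value at [y] is read off the continuation along the segment from [o] to [y], normalised to
    vanish at [o]. For [z] near [y] the two continuations differ by a constant on a tube around the
    segment from [o] to [z], and the normalisation cancels it. *)
Lemma convex_germ_section (D : set V) : open D -> convex_in D ->
  (forall x, D x -> exists f, P x f) -> exists f, forall x, D x -> P x f.
Proof.
move=> Dopen cD ex.
have [[x0 Dx0]|D0] := pselect (exists x, D x); last first.
  by exists (fun=> 0) => x Dx; exfalso; apply: D0; exists x.
pose o := x0; have Do : D o by [].
have G y : exists ef : R * (V -> R), D y -> 0 < ef.1 /\ forall z, tube o y 1 ef.1 z -> P z ef.2.
  have [Dy|nDy] := pselect (D y); last by exists (0, fun=> 0).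
  by have [e [f H]] := tube_germ cD Do Dy ex; exists (e, f).
have [g Hg] := choice G.
exists (fun y => (g y).2 y - (g y).2 o) => y Dy.
have [ey0 Hy] := Hg _ Dy.
have one1 : 0 <= (1:R) <= 1 by rewrite ler01 lexx.
have yT (x : V) e : 0 < e -> tube o x 1 e x.
  by move=> e0; exists 1 => //; rewrite scale1r subrK; exact: ballxx.
have oT (x : V) e : 0 < e -> tube o x 1 e o.
  by move=> e0; exists 0; rewrite ?lexx ?ler01// scale0r add0r; exact: ballxx.
apply: P_ext (P_shift (- (g y).2 o) (Hy _ (yT _ _ ey0))) _.
have ey2 : 0 < (g y).1 / 2 by rewrite divr_gt0.
near=> z.
have Dz : D z by near: z; exact: open_nbhs_nbhs.
have yz : ball y ((g y).1 / 2) z by near: z; exact: nbhsx_ballx.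
have [ez0 Hz] := Hg _ Dz.
(* Half of the width at [y] absorbs the displacement of the segment and the other half the radius
   [d], so this tube lies in the domains of both continuations. *)
pose d := Num.min (g z).1 ((g y).1 / 2).
have d0 : 0 < d by rewrite lt_min ez0.
have [|||c Hc] := @germ_uniq_convex (tube o z 1 d) (g y).2 (g z).2.
- exact: tube_convex.
- move=> w [u /andP[u0 u1] b]; apply: Hy; exists u; first by rewrite u0.
  rewrite (splitr (g y).1); apply: ball_triangle; last first.
    by apply: le_ball b; rewrite ge_min lexx orbT.
  move: yz; rewrite -!ball_normE /ball_/= => yz.
  have -> : u *: (y - o) + o - (u *: (z - o) + o) = u *: (y - z).
    by rewrite opprD addrACA subrr addr0 -scalerBr opprB addrA subrK.
  by rewrite normrZ ger0_norm//; apply: le_lt_trans yz; rewrite ler_piMl.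
- move=> w [u u01 b]; apply: Hz; exists u => //.
  by apply: le_ball b; rewrite ge_min lexx.
rewrite (Hc z (yT _ _ d0)) (Hc o (oT _ _ d0)); ring.
Unshelve. all: by end_near. Qed.

End Continuation.

(** * Charts and the tangent bundle *)

Section Charts.
Context {R : realType} {n : nat} {M : topologicalType}.

Lemma cimgK (c : chart R n M) a : cimg c a ->
  cdom c (cinv c a) /\ cmap c (cinv c a) = a.
Proof. by move=> [x cx <-]; rewrite (cmapK cx). Qed.

Lemma cimg_cmap (c : chart R n M) x : cdom c x -> cimg c (cmap c x).
Proof. by move=> cx; exists x. Qed.

Lemma cimg_near (c : chart R n M) a : cimg c a -> \forall b \near a, cimg c b.
Proof. by move=> ca; apply: open_nbhs_nbhs; split=> //; exact: cimg_open. Qed.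

Lemma cinv_cts (c : chart R n M) a : cimg c a -> {for a, continuous (cinv c)}.
Proof.
move=> ca; have := @cinv_cont _ _ _ c.
by rewrite continuous_open_subspace; [move=> /(_ a); apply; rewrite inE|exact: cimg_open].
Qed.

Lemma cmap_cts (c : chart R n M) x : cdom c x -> {for x, continuous (cmap c)}.
Proof.
move=> cx; have := @cmap_cont _ _ _ c.
by rewrite continuous_open_subspace; [move=> /(_ x); apply; rewrite inE|exact: cdom_open].
Qed.

Lemma cinv_near (c : chart R n M) a (O : set M) : open O -> cimg c a ->
  O (cinv c a) -> \forall b \near a, cimg c b /\ O (cinv c b).
Proof.
move=> Oo ca Oa; near=> b; split; first by near: b; exact: cimg_near.
near: b; have := cinv_cts ca => /(_ O); apply.
exact: open_nbhs_nbhs.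
Unshelve. all: by end_near. Qed.

Variable A : smooth_atlas R n M.
Implicit Types (i j k : idx A) (a : 'rV[R]_n).

Definition overlap i j : set 'rV[R]_n :=
  [set a | cimg (ch i) a /\ cdom (ch j) (cinv (ch i) a)].

Local Notation tr i j := (transition (ch i) (ch j)).

Lemma overlapE i j : overlap i j = cmap (ch i) @` (cdom (ch i) `&` cdom (ch j)).
Proof.
apply/seteqP; split=> [a [ia ja]|a [x [ix jx] <-]].
  by have [ia' <-] := cimgK ia; exists (cinv (ch i) a).
by split; [exact: cimg_cmap|rewrite (cmapK ix)].
Qed.

Lemma overlap_open i j : open (overlap i j).
Proof.
rewrite openE => a [ia ja]; rewrite /interior/=.
by apply: cinv_near => //; exact: cdom_open.
Qed.

Lemma transition_Ck m i j : Ck m (overlap i j) (tr i j).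
Proof. by have /smooth_onP := @ch_smooth _ _ _ A i j; rewrite -overlapE; exact. Qed.

Lemma transition_diff i j a : overlap i j a -> differentiable (tr i j) a.
Proof. exact: (Ck_diff (@transition_Ck 0 i j)). Qed.

Lemma transition_cinv i j a : overlap i j a -> cinv (ch j) (tr i j a) = cinv (ch i) a.
Proof. by move=> [ia ja]; rewrite /transition/= (cmapK ja). Qed.

Lemma transition_cimg i j a : overlap i j a -> cimg (ch j) (tr i j a).
Proof. by move=> [ia ja]; exact: cimg_cmap. Qed.

Lemma transition_overlap i j k a : overlap i j a -> cdom (ch k) (cinv (ch i) a) ->
  overlap j k (tr i j a).
Proof. by move=> ija ka; split; [exact: transition_cimg|rewrite transition_cinv]. Qed.

Lemma transition_trans i j k a : overlap i j a -> tr j k (tr i j a) = tr i k a.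
Proof. by move=> ija; rewrite {1}/transition/= transition_cinv. Qed.

Lemma derive_transition_trans i j k a v : overlap i j a -> overlap i k a ->
  'D_v (tr i k) a = 'D_('D_v (tr i j) a) (tr j k) (tr i j a).
Proof.
move=> ija ika; have jka : overlap j k (tr i j a).
  by apply: transition_overlap => //; case: ika.
rewrite (@near_eq_derive _ _ _ _ (tr j k \o tr i j)); last first.
  by apply: (open_near (@overlap_open i j) ija) => b ijb; rewrite /= transition_trans.
exact: derive_comp_vec (transition_diff ija) (transition_diff jka).
Qed.

Lemma overlap_refl i a : cimg (ch i) a -> overlap i i a.
Proof. by move=> ia; split=> //; case: (cimgK ia). Qed.

Lemma transition_refl i a : cimg (ch i) a -> tr i i a = a.
Proof. by move=> /cimgK[_]. Qed.

Lemma derive_transition_refl i a v : cimg (ch i) a -> 'D_v (tr i i) a = v.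
Proof.
move=> ia; rewrite (@near_eq_derive _ _ _ _ id) ?derive_id//.
by apply: (open_near (@cimg_open _ _ _ (ch i)) ia) => b; exact: transition_refl.
Qed.

Lemma cdom_chart_at x : cdom (ch (chart_at A x)) x.
Proof. exact: (projT2 (cid (ch_cover A x))). Qed.

Lemma overlap_chart_at i a : cimg (ch i) a -> overlap i (chart_at A (cinv (ch i) a)) a.
Proof. by move=> ia; split=> //; exact: cdom_chart_at. Qed.

(** Components are stored in the preferred chart of the base point; by the chain rule for Jacobians
    the stored tangent vector does not depend on the chart used to present it. *)
Lemma tvec_Ttransition i j p : overlap i j p.1 ->
  tvec j (@Ttransition _ _ _ A i j p) = tvec i p.
Proof.
move=> ijp; rewrite /tvec /Ttransition/= transition_cinv//; congr pair.
by rewrite -derive_transition_trans//; apply: overlap_chart_at; case: ijp.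
Qed.

Lemma tvec_chart_at x v : tvec (chart_at A x) (cmap (ch (chart_at A x)) x, v) = (x, v).
Proof.
rewrite /tvec/= (cmapK (cdom_chart_at x)) derive_transition_refl//.
exact/cimg_cmap/cdom_chart_at.
Qed.

Lemma Ttransition_trans i j k p : overlap i j p.1 -> overlap i k p.1 ->
  @Ttransition _ _ _ A j k (@Ttransition _ _ _ A i j p) = Ttransition i k p.
Proof.
move=> ijp ikp; rewrite /Ttransition/= transition_trans//; congr pair.
by rewrite -derive_transition_trans.
Qed.

Lemma tvecZ i a y (l : R) : cimg (ch i) a ->
  @tvec _ _ _ A i (a, l *: y) = ((@tvec _ _ _ A i (a, y)).1, l *: (@tvec _ _ _ A i (a, y)).2).
Proof.
move=> ia; rewrite /tvec/=; congr pair.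
rewrite -[l *: y]addr0 derive_linear ?derive0 ?addr0//.
exact/transition_diff/overlap_chart_at.
Qed.

(** Going from [i] to [j] and back is the identity, so the Jacobian has a left inverse. *)
Lemma derive_transition_eq0 i j a v : overlap i j a -> 'D_v (tr i j) a = 0 -> v = 0.
Proof.
move=> ija D0; have [ia ja] := ija.
by rewrite -[v](derive_transition_refl v ia) (@derive_transition_trans i j)// ?D0 ?derive0//; exact: overlap_refl.
Qed.

Lemma loc_set_T0M i p : loc_set (@T0M R n M) (A := A) i p <-> cimg (ch i) p.1 /\ p.2 != 0.
Proof.
split=> -[ip p0]; split=> //.
  by apply: contra p0 => /eqP p0; rewrite /= p0 derive0.
apply: contra p0 => /eqP/= p0; apply/eqP.
exact: derive_transition_eq0 (overlap_chart_at ip) p0.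
Qed.

Lemma loc_set_Ttransition (U : set (TM R n M)) i j p : overlap i j p.1 ->
  loc_set (A := A) U j (Ttransition i j p) <-> loc_set (A := A) U i p.
Proof.
move=> ijp; rewrite /loc_set/= tvec_Ttransition//.
by split=> -[_ Up]; split=> //; [case: ijp|exact: transition_cimg].
Qed.

Lemma fst_near (V W : normedModType R) (O : set V) (p : V * W) :
  nbhs p.1 O -> \forall q \near p, O q.1.
Proof.
have c1 : {for p, continuous fst} by exact: cvg_fst.
exact: c1.
Qed.

Lemma Ttransition_cts i j (p : 'rV[R]_n * 'rV[R]_n) : overlap i j p.1 -> {for p, continuous (@Ttransition _ _ _ A i j)}.
Proof.
move=> ijp.
have H1 : (tr i j q.1) @[q --> p] --> tr i j p.1.
  apply: (@continuous_comp _ _ _ fst (tr i j)); first exact: cvg_fst.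
  exact/differentiable_continuous/transition_diff.
suff H2 : ('D_(q.2) (tr i j) q.1) @[q --> p] --> 'D_(p.2) (tr i j) p.1 by exact: (cvg_pair H1 H2).
(* Expanding the direction in the basis separates the variables: fibre coordinates times partial
   derivatives that depend on the base point only. *)
pose F (q : 'rV[R]_n * 'rV[R]_n) := \sum_k q.2 0 k *: 'D_(ebasis R k) (tr i j) q.1.
have E : {near p, F =1 (fun q => 'D_(q.2) (tr i j) q.1)}.
  have : \forall q \near p, overlap i j q.1.
    exact: (fst_near (open_nbhs_nbhs (conj (@overlap_open i j) ijp))).
  apply: filterS => q ijq; rewrite /F [in RHS](row_delta_sum q.2) derive_sumv//.
  exact: transition_diff.
have -> : 'D_(p.2) (tr i j) p.1 = F p by rewrite (nbhs_singleton E).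
apply: cvg_trans (near_eq_cvg E) _.
apply: cvg_big => [|k _]; first exact: add_continuous.
apply: cvgZ.
  apply: (@continuous_comp _ _ _ snd (fun y : 'rV[R]_n => y 0 k)); first exact: cvg_snd.
  exact: coord_continuous.
apply: (@continuous_comp _ _ _ fst (fun y => 'D_(ebasis R k) (tr i j) y)); first exact: cvg_fst.
apply: differentiable_continuous.
by apply: (Ck_diff (CkS_derive _ (@transition_Ck 1 i j))).
Qed.

End Charts.

(** * Germs of local metrics *)

Lemma open_nonzero_near (R : realType) (V : normedModType R) (W : set V) (h : V -> R) (p : V) :
  open W -> W p -> {for p, continuous h} -> h p != 0 ->
  (W `&` [set q | h q != 0])° p.
Proof.
move=> Wo Wp hc hp; rewrite /interior /=.
have N : \forall q \near p, `|h p - h q| < `|h p|.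
  by have /cvgrPdist_lt := hc; apply; rewrite normr_gt0.
near=> q; split; first by near: q; exact: open_nbhs_nbhs.
have : `|h p - h q| < `|h p| by near: q; exact: N.
by apply: contraTneq => ->; rewrite subr0 ltxx.
Unshelve. all: by end_near. Qed.

Fact proportional_sub (R : realType) (S t a b x y : R) : S != 0 ->
  S * a = t * x -> S * b = t * y -> a * y - x * b = 0.
Proof.
move=> S0 E E'; apply: (mulfI S0); rewrite mulr0 mulrBr mulrA E mulrCA E'; ring.
Qed.

Fact sum_mulBr (R : realType) m (v a b : 'I_m -> R) (s t : R) :
  (\sum_k v k * a k) * s - t * \sum_k v k * b k = \sum_k v k * (a k * s - t * b k).
Proof.
rewrite mulr_suml mulr_sumr -sumrB; apply: eq_bigr => k _; ring.
Qed.

Fact sum_proportional (R : realType) m (v w a b a' b' : 'I_m -> R) (s t : R) :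
  (forall k, a k * s - t * b k = 0) -> (forall k, a' k * s - t * b' k = 0) ->
  (\sum_k v k * a k + \sum_k w k * a' k) * s -
    t * (\sum_k v k * b k + \sum_k w k * b' k) = 0.
Proof.
move=> H H'; rewrite mulrDl mulrDr opprD addrACA !sum_mulBr.
by rewrite !big1 ?addr0// => k _; rewrite ?H ?H' mulr0.
Qed.

Lemma derive_quotient_eq0 (R : realType) (V : normedModType R) (f g : V -> R) y v :
  differentiable f y -> differentiable g y -> g y != 0 ->
  'D_v f y * g y - f y * 'D_v g y = 0 -> 'D_v (fun q => f q * (g q)^-1) y = 0.
Proof.
move=> df dg g0 key.
have d3 : derivable (fun q => (g q)^-1) y v.
  by apply/diff_derivable/differentiableV.
rewrite -[fun q => _]/(f * (fun q => (g q)^-1)) deriveM//; last exact/diff_derivable.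
rewrite deriveV//; last exact/diff_derivable.
rewrite /GRing.scale/=; move: g0 key; move: ('D_v f y) ('D_v g y) (f y) (g y) => a b x z z0 key.
apply: (mulfI (mulf_neq0 z0 z0)); rewrite mulr0 -[RHS]key expr2; field; exact: z0.
Qed.

Section Metrics.
#[local] Opaque derive.
Context {R : realType} {n : nat} {M : topologicalType}.
Variables (A : smooth_atlas R n M) (G : regular_spray A).
Hypotheses (Gs : scalar_curvature G) (Gr : ricci_neq0_ae G).

Definition local_metric (U : set (TM R n M)) (L : TM R n M -> R) :=
  finsler_metric A U L /\ induces U L G.

Section One.
Variables (U : set (TM R n M)) (L : TM R n M -> R) (c : idx A).
Hypothesis UL : local_metric U L.
Let W := loc_set (A := A) U c.
Let f := loc_fun (A := A) L c.

Lemma metric_open : open W.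
Proof. by case: UL => -[Uo _ _ _] _; exact: Uo. Qed.

Lemma metric_Ck k : Ck k W f.
Proof. by case: UL => -[_ _ _ [/(_ c)/smooth_onP]]. Qed.

Lemma metric_sub : W `<=` loc_set (A := A) (@T0M R n M) c.
Proof.
case: UL => -[_ [UT _] _ _] _ p [ip Up]; split=> //; exact: UT.
Qed.

Lemma metric_neq0 p : W p -> f p != 0.
Proof. by case: UL => -[_ _ L0 _] _ [ip Up]; exact: L0. Qed.

Lemma metric_homog x y (l : R) : 0 < l -> W (x, y) -> f (x, l *: y) = l ^+ 2 * f (x, y).
Proof.
case: UL => -[_ _ _ [_ Lh _]] _ l0 [ip Up].
rewrite /f /loc_fun tvecZ//; move: Up; rewrite [tvec _ _]surjective_pairing => Up.
exact: Lh.
Qed.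

Lemma spray_Ck k : Ck k W (coef G c).
Proof.
have H := (smooth_onP _ _).1 (@coef_smooth _ _ _ _ _ G c) k.
exact: (Ck_sub metric_sub H).
Qed.

Lemma metric_unit p : W p -> gmx f p \in unitmx.
Proof. by case: UL => -[_ _ _ [_ _ +]] _; exact. Qed.

Lemma metric_spray p : W p -> forall i : 'I_n, coef G c p 0 i =
  4%:R^-1 * \sum_(l < n) invmx (gmx f p) i l *
    ((\sum_(k < n) dy l (dx k f) p * p.2 0 k) - dx l f p).
Proof. by case: UL => _; exact. Qed.

Lemma metric_horizontal p l : W p ->
  dx l f p = \sum_i dy l (fun q => coef G c q 0 i) p * dy i f p.
Proof.
exact: (@horizontal_metric _ _ W f (coef G c) metric_open metric_Ck spray_Ck
  metric_homog metric_unit metric_spray).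
Qed.

(** [S] and [tau] come from the spray alone, so the same pair serves every other metric inducing [G]
    near [p]; the metric at hand only certifies [S != 0]. *)
Lemma metric_vertical p : W p -> ricci G c p != 0 ->
  exists S (tau : 'I_n -> R), S != 0 /\
    forall i k, riemann G c i k p = S * (i == k)%:R - tau k * p.2 0 i.
Proof.
move=> Wp r0; have [S [tau [_ _ HS]]] := Gs.
have H i k := HS c p (metric_sub Wp) i k.
exists (loc_fun (A := A) S c p), (fun k => tau c p 0 k); split=> //.
apply: contra_neq r0 => S0.
exact: (@scalar_riemann_ricci _ _ W f (coef G c) metric_open metric_Ck spray_Ck
  metric_homog metric_unit metric_spray p _ (fun k => tau c p 0 k) Wp (metric_neq0 Wp) H S0).
Qed.

Lemma metric_dy p S tau k : W p ->
  (forall i k, riemann G c i k p = S * (i == k)%:R - tau k * p.2 0 i) ->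
  S * dy k f p = 2%:R * tau k * f p.
Proof.
exact: (@scalar_riemann_metric _ _ W f (coef G c) metric_open metric_Ck spray_Ck
  metric_homog metric_unit metric_spray).
Qed.

End One.

Section Two.
Variables (U U' : set (TM R n M)) (L L' : TM R n M -> R) (c : idx A).
Hypotheses (UL : local_metric U L) (UL' : local_metric U' L').
Let W := loc_set (A := A) U c `&` loc_set (A := A) U' c.
Let f := loc_fun (A := A) L c.
Let f' := loc_fun (A := A) L' c.

Lemma metrics_open : open W.
Proof. by apply: openI; [exact: metric_open UL|exact: metric_open UL']. Qed.

(** Equality of the vertical logarithmic derivatives, cleared of denominators. The points where it
    fails would form an open set contained in the null set Ric = 0. *)
Lemma metrics_dy p k : W p -> dy k f p * f' p - f p * dy k f' p = 0.
Proof.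
move=> Wp; apply/eqP/negPn/negP => h0.
pose h q := dy k f q * f' q - f q * dy k f' q.
have Wf m : Ck m W f by apply: Ck_sub (metric_Ck c UL m); move=> q [].
have Wf' m : Ck m W f' by apply: Ck_sub (metric_Ck c UL' m); move=> q [].
have hc : {for p, continuous h}.
  apply: differentiable_continuous; apply: (@Ck_diff _ 0 _ _ W) => //.
  have Wo := metrics_open.
  by apply: CkB => //; apply: CkM => //; [exact: (CkS_derive _ (Wf 1))|exact: (CkS_derive _ (Wf' 1))].
have Dp := open_nonzero_near metrics_open Wp hc h0.
apply: (null_set_not_open (Gr c) (@open_interior _ (W `&` [set q | h q != 0])) Dp).
move=> q /interior_subset[[Uq U'q] hq]; split; first exact: metric_sub UL _ Uq.
apply/eqP; apply: contraNT hq => r0.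
have [S [tau [S0 HS]]] := metric_vertical UL Uq r0.
have E := metric_dy UL k Uq HS; have E' := metric_dy UL' k U'q HS.
apply/eqP; exact: (proportional_sub S0 E E').
Qed.

Lemma metrics_dx p k : W p -> dx k f p * f' p - f p * dx k f' p = 0.
Proof.
move=> [Up U'p]; rewrite (metric_horizontal UL k Up) (metric_horizontal UL' k U'p).
rewrite sum_mulBr big1// => i _.
by rewrite (metrics_dy i (conj Up U'p)) mulr0.
Qed.

Lemma metrics_ratio p : W p ->
  exists2 k, k != 0 & \forall q \near p, f q = k * f' q.
Proof.
move=> Wp; have /nbhs_ballP[r /= r0 rW] : nbhs p W.
  by apply: open_nbhs_nbhs; split=> //; exact: metrics_open.
have f'0 q : W q -> f' q != 0 by move=> [_ U'q]; have := metric_neq0 UL' U'q.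
have f0 q : W q -> f q != 0 by move=> [Uq _]; have := metric_neq0 UL Uq.
have df q : W q -> differentiable f q by move=> [Uq _]; exact: (Ck_diff (metric_Ck c UL 0)).
have df' q : W q -> differentiable f' q by move=> [_ Uq]; exact: (Ck_diff (metric_Ck c UL' 0)).
pose Q := fun q => f q * (f' q)^-1.
have dV q : W q -> differentiable (fun q => (f' q)^-1) q.
  by move=> Wq; apply: differentiableV; [exact: df'|exact: f'0].
have Qc := @derive0_const _ _ Q p r r0.
exists (Q p); first by rewrite mulf_neq0 ?invr_neq0 ?f0 ?f'0.
near=> q; have pq : ball p r q by near: q; exact: nbhsx_ballx.
rewrite -(Qc _ _ q pq).
- by rewrite /Q divfK// f'0//; exact: rW.
- by move=> y /rW Wy; apply: differentiableM; [exact: df|exact: dV].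
move=> y v /rW Wy.
apply: derive_quotient_eq0; [exact: df|exact: df'|exact: f'0|].
rewrite (derive_coords v (df _ Wy)) (derive_coords v (df' _ Wy)).
exact: (sum_proportional _ _ (fun k => metrics_dx k Wy) (fun k => metrics_dy k Wy)).
Unshelve. all: by end_near. Qed.

End Two.

(* F is the logarithm of a local metric up to an additive constant; the factor k
   may be negative and thereby absorbs the sign of L. *)
Definition good (c : idx A) (p : 'rV[R]_n * 'rV[R]_n) (F : 'rV[R]_n * 'rV[R]_n -> R) :=
  exists U L k, [/\ local_metric U L, loc_set (A := A) U c p, k != 0 &
    \forall q \near p, expR (F q) = k * loc_fun (A := A) L c q].

Lemma good_ext c p f g : good c p f -> (\forall q \near p, f q = g q) -> good c p g.
Proof.
move=> [U [L [k [UL Up k0 E]]]] fg; exists U, L, k; split=> //.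
by near=> q; rewrite -(near fg q)//; near: q.
Unshelve. all: by end_near. Qed.

Lemma good_shift c p f (a : R) : good c p f -> good c p (fun q => f q + a).
Proof.
move=> [U [L [k [UL Up k0 E]]]]; exists U, L, (expR a * k); split=> //.
  by rewrite mulf_neq0// gt_eqF// expR_gt0.
by near=> q; rewrite expRD (near E q)// mulrC mulrA.
Unshelve. all: by end_near. Qed.

Lemma good_open c p f : good c p f -> \forall q \near p, good c q f.
Proof.
move=> [U [L [k [UL Up k0 E]]]].
have Un : \forall q \near p, loc_set (A := A) U c q.
  by apply: open_nbhs_nbhs; split=> //; exact: metric_open UL.
move/near_join : E => E; near=> q; exists U, L, k; split=> //; by near: q.
Unshelve. all: by end_near. Qed.

Lemma good_uniq c p f g : good c p f -> good c p g ->
  exists a, \forall q \near p, f q = g q + a.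
Proof.
move=> [U [L [k [UL Up k0 E]]]] [U' [L' [k' [UL' Up' k0' E']]]].
have [a a0 ratio] := metrics_ratio UL UL' (conj Up Up').
have key : \forall q \near p, expR (f q) = k * a / k' * expR (g q).
  near=> q; rewrite (near E q)// (near E' q)// (near ratio q)//.
  by field.
(* The factor [k * a / k'] is the exponential of this difference, as evaluating [key] at [p] shows;
   in particular it is positive although its three constituents may be negative. *)
exists (f p - g p); near=> q.
apply: (@expR_inj R); rewrite expRD (near key q)// expRD expRN (nbhs_singleton key).
have := expR_gt0 (g p); move: (expR (g p)) (expR (g q)) => x y /gt_eqF/negbT x0.
by field; rewrite x0 k0'.
Unshelve. all: by end_near. Qed.

Lemma good_exists c p : locally_metrizable G ->
  loc_set (A := A) (@T0M R n M) c p -> exists f, good c p f.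
Proof.
move=> Gl [cp zp]; have [U [Uo Uc Uz UT [L [LU Li]]]] := Gl _ zp.
have UL : local_metric U L by split.
have Up : loc_set (A := A) U c p by split.
pose f := loc_fun (A := A) L c.
have fp := metric_neq0 UL Up.
(* On the neighbourhood where [f] differs from [f p] by less than its absolute value, [f] keeps its
   sign, so the absolute value is [f] times a constant sign. *)
exists (fun q => ln `|f q|), U, L, (Num.sg (f p)); split=> //; first by rewrite sgr_eq0.
have : \forall q \near p, `|f p - f q| < `|f p|.
  have fc : {for p, continuous f}.
    exact: differentiable_continuous (Ck_diff (metric_Ck c UL 0) Up).
  by have /cvgrPdist_lt := fc; apply; rewrite normr_gt0.
apply: filterS => q; have fp' : f p != 0 by exact: fp.
rewrite -/(f p) -/(f q); move: (f p) (f q) fp' => x y x0 xy.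
have y0 : y != 0 by apply: contraTneq xy => ->; rewrite subr0 ltxx.
rewrite lnK ?posrE ?normr_gt0//.
move: x0; rewrite neq_lt => /orP[x0|x0]; move: xy.
  rewrite ltr0_sg// (ltr0_norm x0) ltr_norml => /andP[h1 h2].
  by rewrite ltr0_norm ?mulN1r//; lra.
rewrite gtr0_sg// (gtr0_norm x0) ltr_norml => /andP[h1 h2].
by rewrite gtr0_norm ?mul1r//; lra.
Qed.

Lemma good_transfer i j p F : overlap i j p.1 ->
  good j (Ttransition i j p) F -> good i p (F \o @Ttransition _ _ _ A i j).
Proof.
move=> ijp [U [L [k [UL Up k0 E]]]]; exists U, L, k.
have E' : \forall q \near p, expR (F (Ttransition i j q)) = k * loc_fun (A := A) L j (Ttransition i j q).
  exact: (Ttransition_cts ijp E).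
have ov : \forall q \near p, overlap i j q.1.
  by apply: (fst_near (O := overlap i j)); apply: open_nbhs_nbhs; split=> //; exact: overlap_open.
split; [exact: UL|exact/(loc_set_Ttransition U ijp)|exact: k0|].
near=> q; have ijq : overlap i j q.1 by near: q.
have Eq : expR (F (Ttransition i j q)) = k * loc_fun (A := A) L j (Ttransition i j q) by near: q.
by rewrite [LHS]Eq /loc_fun (tvec_Ttransition ijq).
Unshelve. all: by end_near.
Qed.

End Metrics.

(** * Gluing over the punctured fibres *)

Section PuncturedFibres.
Context {R : realType} {n : nat}.
Notation TMc := ('rV[R]_n * 'rV[R]_n)%type.
Variable P : TMc -> (TMc -> R) -> Prop.
Hypothesis P_ext : forall x f g, P x f -> (\forall y \near x, f y = g y) -> P x g.
Hypothesis P_uniq : forall x f g, P x f -> P x g ->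
  exists c, \forall y \near x, f y = g y + c.
Hypothesis P_shift : forall x f c, P x f -> P x (fun y => f y + c).
Hypothesis P_open : forall x f, P x f -> \forall y \near x, P y f.
Variable B : set 'rV[R]_n.
Hypotheses (Bo : open B) (Bc : convex_in B).
Hypothesis P_ex : forall p : TMc, B p.1 -> p.2 != 0 -> exists f, P p f.

Definition bsign (s : bool) : R := if s then 1 else -1.

Definition half_space (ks : 'I_n * bool) : set TMc :=
  [set p : TMc | B p.1 /\ 0 < bsign ks.2 * p.2 0 ks.1].

Lemma half_space_open ks : open (half_space ks).
Proof.
rewrite openE => p [Bp sp]; rewrite /interior/=.
have c1 : {for p, continuous fst} by exact: cvg_fst.
have c2 : {for p, continuous (fun q : TMc => bsign ks.2 * q.2 0 ks.1)}.
  apply: cvgM; first exact: cvg_cst.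
  apply: (@continuous_comp _ _ _ snd (fun y : 'rV[R]_n => y 0 ks.1)); first exact: cvg_snd.
  exact: coord_continuous.
have n1 : \forall q \near p, B q.1 by apply: (c1 B); exact: open_nbhs_nbhs.
have n2 : \forall q \near p, (fun q : TMc => 0 < bsign ks.2 * q.2 0 ks.1) q.
  apply: (c2 [set x | 0 < x]); apply: open_nbhs_nbhs; split=> //; exact: open_gt.
by near=> q; split; near: q.
Unshelve. all: by end_near. Qed.

Lemma half_space_convex ks : convex_in (half_space ks).
Proof.
move=> p q t [Bp sp] [Bq sq] /andP[t0 t1]; split => /=.
  by apply: Bc; rewrite ?t0.
rewrite !mxE; move: sp sq; move: (p.2 0 ks.1) (q.2 0 ks.1) (bsign ks.2) => x y s sp sq.
have -> : s * (t * (y - x) + x) = t * (s * y) + (1 - t) * (s * x) by ring.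
have [->|tn0] := eqVneq t 0; first by rewrite mul0r add0r subr0 mul1r.
apply: ltr_wpDr; first by rewrite mulr_ge0 ?subr_ge0// ltW.
by rewrite mulr_gt0// lt_def tn0.
Qed.

Lemma convex_inI (D E : set TMc) : convex_in D -> convex_in E -> convex_in (D `&` E).
Proof. by move=> cD cE x y t [Dx Ex] [Dy Ey] t01; split; [exact: cD|exact: cE]. Qed.

Let section_on (D : set TMc) f := forall p, D p -> P p f.

Lemma half_space_section ks : exists f, section_on (half_space ks) f.
Proof.
apply: (convex_germ_section P_ext P_uniq P_shift P_open (@half_space_open ks)).
  exact: half_space_convex.
move=> p [Bp sp]; apply: P_ex => //; apply: contraTneq sp => ->.
by rewrite mxE mulr0 ltxx.
Qed.

Lemma half_space_align ks lt f : section_on (half_space lt) f ->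
  exists2 g, section_on (half_space ks) g &
    forall p, half_space ks p -> half_space lt p -> g p = f p.
Proof.
move=> Hf; have [g Hg] := half_space_section ks.
have [|||a Ha] := germ_uniq_convex P_uniq (D := half_space ks `&` half_space lt) (f := f) (g := g).
- by apply: convex_inI; exact: half_space_convex.
- by move=> p [_ /Hf].
- by move=> p [/Hg].
exists (fun p => g p + a); first by move=> p /Hg; exact: P_shift.
by move=> p kp lp; rewrite Ha.
Qed.

Lemma half_space_agree ks lt f g p : section_on (half_space ks) f ->
  section_on (half_space lt) g -> half_space ks p -> half_space lt p -> f p = g p ->
  forall q, half_space ks q -> half_space lt q -> f q = g q.
Proof.
move=> Hf Hg kp lp fg q kq lq.
have [|||a Ha] := germ_uniq_convex P_uniq (D := half_space ks `&` half_space lt) (f := f) (g := g).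
- by apply: convex_inI; exact: half_space_convex.
- by move=> z [/Hf].
- by move=> z [_ /Hg].
have a0 : a = 0 by apply: (addrI (g p)); rewrite addr0 -Ha.
by rewrite Ha// a0 addr0.
Qed.

Lemma half_space3 k l m s t u x : B x -> k != l -> k != m -> l != m ->
  exists p, [/\ half_space (k, s) p, half_space (l, t) p & half_space (m, u) p].
Proof.
move=> Bx kl km lm.
exists (x, \row_j (if j == k then bsign s else if j == l then bsign t else bsign u)).
have ss b : 0 < bsign b * bsign b :> R by case: b; rewrite /bsign ?mulrNN mulr1.
split; split=> //=; rewrite mxE.
- by rewrite eqxx.
- by rewrite eq_sym (negbTE kl) eqxx.
- by rewrite eq_sym (negbTE km) eq_sym (negbTE lm).
Qed.

Lemma half_space_pick (k0 : 'I_n) (p : TMc) :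
  exists ks, B p.1 -> p.2 != 0 -> half_space ks p.
Proof.
(* The index [k0] is only a default for the zero vector; stating the premises inside the existential
   turns the lemma into a total choice function. *)
have [p0|p0] := boolP (p.2 == 0); first by exists (k0, true) => _ /negP[].
have /existsP[k pk] : [exists k, p.2 0 k != 0].
  apply: contraNT p0 => /existsPn h; apply/eqP/rowP => k; rewrite mxE.
  by have := h k; rewrite negbK => /eqP.
exists (k, 0 < p.2 0 k) => Bp _; split=> //=.
rewrite /bsign; case: (ltP 0 (p.2 0 k)) => h; first by rewrite mul1r.
by rewrite mulN1r oppr_gt0 lt_def eq_sym pk.
Qed.

(** Each half-space carries its own constant, and half-spaces with different indices meet, so their
    constants agree. Opposite half-spaces are disjoint and are compared through another index. *)
Lemma punctured_uniq f g : (3 <= n)%N ->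
  (forall p : TMc, B p.1 -> p.2 != 0 -> P p f) ->
  (forall p : TMc, B p.1 -> p.2 != 0 -> P p g) ->
  exists a, forall p : TMc, B p.1 -> p.2 != 0 -> f p = g p + a.
Proof.
move=> n3 Pf Pg; have [[x Bx]|B0] := pselect (exists x, B x); last first.
  by exists 0 => p Bp; exfalso; apply: B0; exists p.1.
have HP h ks : (forall p : TMc, B p.1 -> p.2 != 0 -> P p h) -> section_on (half_space ks) h.
  move=> Ph p [Bp sp]; apply: Ph => //; apply: contraTneq sp => ->.
  by rewrite mxE mulr0 ltxx.
have /choice[a Ha] : forall ks, exists a, forall p, half_space ks p -> f p = g p + a.
  move=> ks; apply: (germ_uniq_convex P_uniq (@half_space_convex ks)); exact: HP.
pose k0 := Ordinal (leq_trans (isT : 0 < 3)%N n3).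
pose k1 := Ordinal (leq_trans (isT : 1 < 3)%N n3).
pose k2 := Ordinal (leq_trans (isT : 2 < 3)%N n3).
have third (k l : 'I_n) : exists m, (k != m) && (l != m).
  have [h0|] := boolP ((k != k0) && (l != k0)); first by exists k0.
  have [h1|] := boolP ((k != k1) && (l != k1)); first by exists k1.
  rewrite !negb_and !negbK => h1 h0; exists k2.
  move: h0 h1; rewrite -!val_eqE/=.
  by case: (nat_of_ord k) => [|[|[|?]]]; case: (nat_of_ord l) => [|[|[|?]]].
have aE k s l t : k != l -> a (k, s) = a (l, t).
  move=> kl; have [m /andP[km lm]] := third k l.
  have [p [kp lp _]] := half_space3 s t true Bx kl km lm.
  by apply: (addrI (g p)); rewrite -(Ha _ _ kp) -(Ha _ _ lp).
exists (a (k0, true)) => p Bp p0; have [[k s] Hks] := half_space_pick k0 p.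
rewrite (Ha _ _ (Hks Bp p0)); congr (_ + _).
have [m /andP[km k0m]] := third k k0.
by rewrite (aE _ _ m true)// [RHS](aE _ _ m true).
Qed.

(* The 2n half-spaces +-y_k > 0 cover the fibre minus 0 and any three with
   distinct indices meet, so their nerve (an octahedral sphere) is simply
   connected for n >= 3.  Sections on k <> k0 are normalised against y_k0 > 0; the
   section on y_k0 < 0 is normalised against y_k1 > 0 and compared with
   y_k1 < 0 through k2. *)
Lemma punctured_section : (3 <= n)%N -> exists f, forall p : TMc, B p.1 -> p.2 != 0 -> P p f.
Proof.
move=> n3; have [[x Bx]|B0] := pselect (exists x, B x); last first.
  by exists (fun=> 0) => p Bp; exfalso; apply: B0; exists p.1.
pose k0 := Ordinal (leq_trans (isT : 0 < 3)%N n3).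
pose k1 := Ordinal (leq_trans (isT : 1 < 3)%N n3).
pose k2 := Ordinal (leq_trans (isT : 2 < 3)%N n3).
have [f0 Hf0] := half_space_section (k0, true).
have /choice[F HF] : forall ks, exists f, section_on (half_space ks) f /\
    forall p, half_space ks p -> half_space (k0, true) p -> f p = f0 p.
  by move=> ks; have [f Hf E] := half_space_align ks Hf0; exists f.
have FF k l s t : k != k0 -> l != k0 -> k != l ->
    forall q, half_space (k, s) q -> half_space (l, t) q -> F (k, s) q = F (l, t) q.
  move=> kk0 lk0 kl; have [p [kp lp p0]] := half_space3 s t true Bx kl kk0 lk0.
  have [Hk Ek] := HF (k, s); have [Hl El] := HF (l, t).
  by apply: (half_space_agree Hk Hl kp lp); rewrite Ek// El.
have [H1 _] := HF (k1, true).
have [g Hg Eg] := half_space_align (k0, false) H1.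
have gF' k l s : k != k0 -> l != k0 -> k != l ->
    (forall q, half_space (k0, false) q -> half_space (k, true) q -> g q = F (k, true) q) ->
    forall q, half_space (k0, false) q -> half_space (l, s) q -> g q = F (l, s) q.
  move=> kk0 lk0 kl Ek; rewrite eq_sym in kk0; rewrite eq_sym in lk0.
  have [p [p0 kp lp]] := half_space3 false true s Bx kk0 lk0 kl.
  have [Hl _] := HF (l, s).
  apply: (half_space_agree Hg Hl p0 lp); rewrite Ek//; apply: FF => //; rewrite eq_sym//.
have gF l s : l != k0 -> forall q, half_space (k0, false) q -> half_space (l, s) q -> g q = F (l, s) q.
  move=> lk0; have [->|lk1] := eqVneq l k1; last first.
    by apply: (gF' k1) => //; rewrite eq_sym.
  by apply: (gF' k2) => //; apply: (gF' k1).
pose H ks := if ks == (k0, true) then f0 else if ks == (k0, false) then g else F ks.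
have HS ks : section_on (half_space ks) (H ks).
  rewrite /H; case: eqP => [->//|_]; case: eqP => [->//|_].
  by have [] := HF ks.
(* By symmetry one of the two indices may be taken different from [k0]: if both equal [k0], the
   half-spaces coincide or are disjoint. *)
have HH ks lt q : half_space ks q -> half_space lt q -> H ks q = H lt q.
  wlog lk0 : ks lt / lt.1 != k0 => [hw|].
    have [l0|] := eqVneq lt.1 k0; last exact: hw.
    have [k0'|kk0] := eqVneq ks.1 k0; last by move=> *; rewrite (hw lt ks).
    case: ks lt k0' l0 => [k s] [l t] /= -> ->.
    case: s t => -[] // [_ h1] [_ h2]; exfalso; move: h1 h2; rewrite /bsign/=; lra.
  case: lt lk0 => l t /= lk0.
  have Hl : H (l, t) = F (l, t).
    by rewrite /H !xpair_eqE (negbTE lk0).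
  rewrite Hl; case: ks => k s; have [->|kk0] := eqVneq k k0; last first.
    rewrite /H !xpair_eqE (negbTE kk0)/=; have [->|kl] := eqVneq k l; last exact: FF.
    case: s t {Hl} => -[] // [_ h1] [_ h2]; exfalso; move: h1 h2; rewrite /bsign/=; lra.
  rewrite /H !xpair_eqE eqxx/=; case: s => /=.
    by move=> hk hl; have [_ ->] := HF (l, t).
  by move=> *; exact: gF.
have /choice[c Hc] := half_space_pick k0.
(* The choice [c] may jump from point to point; by [HH] the value near [p] is nevertheless that of
   the single section [H (c p)]. *)
exists (fun p => H (c p) p) => p Bp p0.
have Hp := Hc _ Bp p0.
apply: P_ext (HS _ _ Hp) _.
have nH : \forall q \near p, half_space (c p) q.
  by apply: open_nbhs_nbhs; split=> //; exact: half_space_open.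
near=> q; have Hq : half_space (c p) q by near: q.
apply: HH => //; apply: Hc; first by case: Hq.
by case: Hq => _; apply: contraTneq => ->; rewrite mxE mulr0 ltxx.
Unshelve. all: by end_near. Qed.

End PuncturedFibres.

(** * Bump functions *)

Section Bump.
Context {R : realType}.

(* t^-k exp(-1/t) for t > 0: a family closed under derivation up to linear
   combinations. *)
Definition flat (k : nat) (t : R) : R := if 0 < t then t^-1 ^+ k * expR (- t^-1) else 0.

Lemma flat_ge0 k t : 0 <= flat k t.
Proof.
by rewrite /flat; case: ltP => // t0; rewrite mulr_ge0 ?expR_ge0// exprn_ge0// invr_ge0 ltW.
Qed.

(** One term of the exponential series bounds t^-(k+1) by (k+1)! exp(1/t). For [k.+1] this controls
    the difference quotient of [flat k] at 0. *)
Lemma flat_bound k t : flat k t <= (k.+1)`!%:R * `|t|.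
Proof.
rewrite /flat; case: ltP => t0; last by rewrite mulr_ge0.
rewrite gtr0_norm// expRN ler_pdivrMr ?expR_gt0//.
have u0 : 0 < t^-1 by rewrite invr_gt0.
have f0 : 0 < (k.+1)`!%:R :> R by rewrite ltr0n fact_gt0.
have h : t^-1 ^+ k.+1 <= (k.+1)`!%:R * expR t^-1.
  rewrite -ler_pdivrMl// mulrC; apply: le_trans (expR_ge1Dxn k (ltW u0)).
  by rewrite lerDr.
have := ler_wpM2l (ltW t0) h; rewrite exprS mulrA mulfV ?gt_eqF// mul1r.
by move=> /le_trans; apply; rewrite mulrCA mulrA.
Qed.

Lemma is_derive_flat_pos k (t : R) : 0 < t ->
  is_derive t 1 (flat k) (flat k.+2 t - k%:R * flat k.+1 t).
Proof.
move=> t0; have tn0 : t != 0 by rewrite gt_eqF.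
pose u (y : R) := y^-1.
have du : is_derive t 1 u (- t ^- 2).
  by apply: is_derive_eq (@is_deriveV R id t 1 1 tn0 (is_derive_id t 1)) _; rewrite /GRing.scale/= mulr1.
have dN : is_derive t 1 (- u) (t ^- 2).
  by apply: is_derive_eq (is_deriveN du) _; rewrite opprK.
have dE : is_derive t 1 (expR \o (- u)) (expR (- t^-1) * t ^- 2).
  exact: is_derive1_comp (is_derive_expR _) dN.
have dX : is_derive t 1 (u ^+ k) (- (k%:R * t^-1 ^+ k.+1)).
  case: k => [|k].
    by rewrite expr0 mul0r oppr0; exact: is_derive_cst.
  apply: is_derive_eq (@is_deriveX R R u k.+1 t 1 _ du) _.
  rewrite /GRing.scale/= /u; rewrite -exprVn !exprS; ring.
have uE s : (u ^+ k) s = s^-1 ^+ k.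
  by elim: k {dX} => [|k IH]; [rewrite !expr0|rewrite [in RHS]exprS -IH exprS].
have dM := is_deriveM dX dE.
apply: (near_eq_is_derive (f := (u ^+ k) * (expR \o - u))).
  have : \forall s \near t, 0 < s by apply: open_nbhs_nbhs; split=> //; exact: open_gt.
  by apply: filterS => s s0; rewrite /flat s0 -uE.
apply: is_derive_eq dM _; rewrite /flat t0 uE.
have -> : (expR \o - u) t = expR (- t^-1) by [].
rewrite -exprVn !exprS /GRing.scale/=; ring.
Qed.

Lemma is_derive_flat k (t : R) : is_derive t 1 (flat k) (flat k.+2 t - k%:R * flat k.+1 t).
Proof.
have [t0|t0|<-] := ltgtP 0 t; first exact: is_derive_flat_pos.
  have -> : flat k.+2 t - k%:R * flat k.+1 t = 0.
    by rewrite /flat ltNge (ltW t0)/= mulr0 subrr.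
  have N : \forall s \near t, cst (0 : R) s = flat k s.
    have : \forall s \near t, s < 0 by apply: open_nbhs_nbhs; split=> //; exact: open_lt.
    by apply: filterS => s s0; rewrite /flat ltNge (ltW s0).
  exact: (near_eq_is_derive N (is_derive_cst (0 : R) t 1)).
have -> : flat k.+2 0 - k%:R * flat k.+1 0 = 0 by rewrite /flat ltxx mulr0 subrr.
(* The difference quotient at 0 is [flat k.+1 h], which tends to 0 by the linear bound. *)
have C : h^-1 *: (flat k (h *: 1 + 0) - flat k 0) @[h --> (0:R)^'] --> (0 : R).
  apply/cvgrPdist_le => e e0; near=> h.
  have fl : flat k 0 = 0 by rewrite /flat ltxx.
  rewrite sub0r normrN fl subr0 addr0 /GRing.scale/= mulr1.
  have h0 : h != 0 by near: h; exact: nbhs_dnbhs_neq.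
  have -> : h^-1 * flat k h = flat k.+1 h.
    by rewrite /flat; case: ltP => // _; [rewrite exprS mulrA|rewrite mulr0].
  rewrite ger0_norm ?flat_ge0//; apply: le_trans (flat_bound _ _) _.
  have f0 : 0 < (k.+2)`!%:R :> R by rewrite ltr0n fact_gt0.
  rewrite -ler_pdivlMl//; apply: ltW; near: h; apply: dnbhs0_lt.
  by rewrite mulr_gt0// invr_gt0.
apply: DeriveDef; first by apply/cvg_ex; exists 0.
by rewrite /derive; exact: (cvg_lim _ C).
Unshelve. all: by end_near. Qed.

Lemma flat_Ck m k : Ck m setT (flat k).
Proof.
have df j t : differentiable (flat j) t.
  by apply/derivable1_diffP; have [] := is_derive_flat j t.
elim: m k => [|m IH] k; first by split=> // t _; exact: df.
apply/CkSP; split=> [t _|v]; first exact: df.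
apply: (@Ck_eq _ _ _ _ _ (fun t => v * (flat k.+2 t - k%:R * flat k.+1 t))); first exact: openT.
  move=> t _; have -> : v = v *: 1 + 0 by rewrite addr0 /GRing.scale/= mulr1.
  rewrite derive_linear// derive0 addr0 /GRing.scale/= addr0 mulr1.
  by have [_ ->] := is_derive_flat k t.
by apply: CkZ; [exact: openT|apply: CkB; [exact: openT|exact: IH|apply: CkZ; [exact: openT|exact: IH]]].
Qed.

Lemma flat0_gt0 (t : R) : 0 < t -> 0 < flat 0 t.
Proof. by move=> t0; rewrite /flat t0 expr0 mul1r expR_gt0. Qed.

Lemma flat0_eq0 (t : R) : t <= 0 -> flat 0 t = 0.
Proof. by rewrite /flat leNgt => /negbTE ->. Qed.

Definition smooth_step (t : R) : R := flat 0 t / (flat 0 t + flat 0 (1 - t)).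

Lemma smooth_step_den (t : R) : flat 0 t + flat 0 (1 - t) != 0.
Proof.
rewrite gt_eqF//; have [t0|t0] := ltP 0 t.
  by rewrite ltr_wpDr ?flat_ge0// flat0_gt0.
by rewrite ltr_wpDl ?flat_ge0// flat0_gt0//; lra.
Qed.

Lemma smooth_step0 (t : R) : t <= 0 -> smooth_step t = 0.
Proof. by move=> t0; rewrite /smooth_step flat0_eq0// mul0r. Qed.

Lemma smooth_step1 (t : R) : 1 <= t -> smooth_step t = 1.
Proof.
move=> t1; have := smooth_step_den t; rewrite /smooth_step.
by rewrite (@flat0_eq0 (1 - t)) ?addr0; [exact: mulfV|lra].
Qed.

Lemma Ck_comp_affine m (f : R -> R) (a b : R) :
  (forall m, Ck m setT f) -> Ck m setT (fun t => f (a * t + b)).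
Proof.
move=> Cf; apply: (@Ck_comp_R _ m _ setT setT (fun t : R => a * t + b) f) => //; first exact: openT.
by apply: CkD; [exact: openT|apply: CkZ; [exact: openT|exact: Ck_id]|exact: Ck_cst].
Qed.

Lemma smooth_step_Ck m : Ck m setT smooth_step.
Proof.
have oT : open [set: R] by exact: openT.
apply: CkM => //; first exact: flat_Ck.
apply: CkV => //; first by move=> t _; exact: smooth_step_den.
apply: CkD => //; first exact: flat_Ck.
apply: (Ck_eq oT) (Ck_comp_affine m (-1) 1 (fun m => flat_Ck m 0)) => t _.
by congr (flat 0 _); ring.
Qed.

Definition bump1 (t : R) : R := smooth_step (2%:R - t) * smooth_step (2%:R + t).

Lemma bump1_Ck m : Ck m setT bump1.
Proof.
have oT : open [set: R] by exact: openT.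
apply: CkM => //.
  apply: (Ck_eq oT) (Ck_comp_affine m (-1) 2%:R smooth_step_Ck) => t _.
  by congr smooth_step; ring.
apply: (Ck_eq oT) (Ck_comp_affine m 1 2%:R smooth_step_Ck) => t _.
by congr smooth_step; ring.
Qed.

Lemma bump1_eq1 (t : R) : `|t| <= 1 -> bump1 t = 1.
Proof.
by rewrite ler_norml => /andP[h1 h2]; rewrite /bump1 !smooth_step1 ?mulr1//; lra.
Qed.

Lemma bump1_eq0 (t : R) : 2%:R <= `|t| -> bump1 t = 0.
Proof.
rewrite ler_normr => /orP[h|h]; rewrite /bump1.
  by rewrite smooth_step0 ?mul0r//; lra.
by rewrite [X in _ * X]smooth_step0 ?mulr0//; lra.
Qed.

Context {n : nat}.

(** A product over coordinates suits the sup norm: it is 1 on the ball of radius [r], a cube, and is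
    supported in the compact cube of twice the size. *)
Definition bump_fun (a : 'rV[R]_n) (r : R) (b : 'rV[R]_n) : R :=
  \prod_i bump1 (r^-1 * (b 0 i - a 0 i)).

Lemma bump_Ck m a r : Ck m setT (bump_fun a r).
Proof.
have oT : open [set: 'rV[R]_n] by exact: openT.
apply: Ck_prod => // i.
apply: (@Ck_comp_R _ m _ setT setT (fun b : 'rV[R]_n => r^-1 * (b 0 i - a 0 i)) bump1) => //.
  apply: CkZ => //; apply: CkB => //; last exact: Ck_cst.
  by apply: Ck_coord => //; exact: Ck_id.
exact: bump1_Ck.
Qed.

Lemma bump_eq1 a r b : 0 < r -> ball a r b -> bump_fun a r b = 1.
Proof.
move=> r0 /(ball_rV _ _ r0) ab; apply: big1 => i _; apply: bump1_eq1.
have := ab i; rewrite -ball_normE /ball_/= distrC => /ltW h.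
by rewrite normrM normfV (gtr0_norm r0) ler_pdivrMl// mulr1.
Qed.

Lemma bump_neq0 a r b : 0 < r -> bump_fun a r b != 0 ->
  forall i, a 0 i - 2%:R * r <= b 0 i <= a 0 i + 2%:R * r.
Proof.
move=> r0 b0 i; suff : `|b 0 i - a 0 i| <= 2%:R * r.
  by rewrite ler_norml => /andP[h1 h2]; apply/andP; split; lra.
rewrite leNgt; apply: contra b0 => h; rewrite /bump_fun (bigD1 i)//= bump1_eq0 ?mul0r//.
by rewrite normrM normfV (gtr0_norm r0) ler_pdivlMl// mulrC ltW.
Qed.

End Bump.

(** * Partitions of unity and the first de Rham group *)

Lemma Ck_near (R : realType) k (V W : normedModType R) (D : set V) (f : V -> W) :
  (forall x, D x -> exists E g, [/\ open E, E x, Ck k E g & \forall y \near x, g y = f y]) ->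
  Ck k D f.
Proof.
move=> H; apply: Ck_local => x /H[E [g [Eo Ex Eg gf]]].
exists (E `&` [set y | g y = f y]°); first by split.
apply: (@Ck_eq _ _ _ _ _ g).
- by apply: openI => //; exact: open_interior.
- by move=> y [_ /interior_subset].
by apply: Ck_sub Eg => y [].
Qed.

(** Indexing by data [D] with a validity predicate lets the sequence carry more than open sets.
    Entry [k] is a datum whose set contains the basic open set of code [k], or the default [d0] if
    there is none. *)
Lemma lindelof (T : topologicalType) (D : Type) (d0 : D) (V : D -> Prop) (O : D -> set T) :
  @second_countable T -> V d0 -> (forall x : T, exists2 d, V d & nbhs x (O d)) ->
  exists s : nat -> D, (forall k, V (s k)) /\ forall x : T, exists k, nbhs x (O (s k)).
Proof.
move=> [B cB [Bo Bb]] V0 H.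
have [f finj] := countable_injP _ cB.
have /choice[s Hs] : forall k, exists d, V d /\
    forall b, B b -> f b = k -> (exists2 d, V d & b `<=` O d) -> b `<=` O d.
  move=> k; have [[b [Bb' fb [d Vd bd]]]|nb] :=
      pselect (exists b, [/\ B b, f b = k & exists2 d, V d & b `<=` O d]).
    exists d; split=> // b' Bb'' fb' _; suff -> : b' = b by [].
    by apply: finj; rewrite ?inE// fb'.
  by exists d0; split=> // b B1 B2 B3; exfalso; apply: nb; exists b.
exists s; split; first by move=> k; have [] := Hs k.
move=> x; have [d Vd xd] := H x.
have [b [Bb' bx] bd] := Bb x _ xd.
exists (f b); have [_ /(_ b Bb' erefl)] := Hs (f b).
move=> /(_ (ex_intro2 _ _ d Vd bd)) /filterS; apply.
by apply: open_nbhs_nbhs; split=> //; exact: Bo.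
Qed.

Section SmoothManifold.
Context {R : realType} {n : nat} {M : topologicalType}.
Variable A : smooth_atlas R n M.

Definition chart_preimage (c : idx A) (N : set M) : set 'rV[R]_n :=
  [set a | cimg (ch c) a /\ N (cinv (ch c) a)].

Definition smooth_in (N : set M) (f : M -> R) :=
  forall (c : idx A) m, Ck m (chart_preimage c N) (f \o cinv (ch c)).

Lemma chart_preimage_open c N : open N -> open (chart_preimage c N).
Proof.
move=> No; rewrite openE => a [ca Na]; rewrite /interior/=.
exact: cinv_near.
Qed.

Lemma smooth_in_near N f : open N ->
  (forall x, N x -> exists E g, [/\ open E, E x, smooth_in E g & \forall y \near x, g y = f y]) ->
  smooth_in N f.
Proof.
move=> No H c m; apply: Ck_near => a [ca Na].
have [E [g [Eo Ex Eg gf]]] := H _ Na.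
exists (chart_preimage c E), (g \o cinv (ch c)); split=> //.
- exact: chart_preimage_open.
have := cinv_cts ca gf; exact.
Qed.

Lemma smooth_in_cst N (r : R) : smooth_in N (fun=> r).
Proof. by move=> c m; exact: Ck_cst. Qed.

Lemma smooth_inM N f g : open N -> smooth_in N f -> smooth_in N g ->
  smooth_in N (fun x => f x * g x).
Proof. by move=> No Hf Hg c m; apply: CkM; [exact: chart_preimage_open|exact: Hf|exact: Hg]. Qed.

Lemma smooth_inB N f g : open N -> smooth_in N f -> smooth_in N g ->
  smooth_in N (fun x => f x - g x).
Proof. by move=> No Hf Hg c m; apply: CkB; [exact: chart_preimage_open|exact: Hf|exact: Hg]. Qed.

Lemma smooth_in_sum N (I : Type) (r : seq I) (F : I -> M -> R) : open N ->
  (forall i, smooth_in N (F i)) -> smooth_in N (fun x => \sum_(i <- r) F i x).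
Proof. by move=> No HF c m; apply: Ck_sum => [|i]; [exact: chart_preimage_open|exact: HF]. Qed.

Lemma smooth_in_prod N (I : Type) (r : seq I) (F : I -> M -> R) : open N ->
  (forall i, smooth_in N (F i)) -> smooth_in N (fun x => \prod_(i <- r) F i x).
Proof. by move=> No HF c m; apply: Ck_prod => [|i]; [exact: chart_preimage_open|exact: HF]. Qed.

Lemma cube_rV_compact (a : 'rV[R]_n) (h : R) :
  compact [set b : 'rV[R]_n | forall i, a 0 i - h <= b 0 i <= a 0 i + h].
Proof.
have := @rV_compact R n (fun i => `[a 0 i - h, a 0 i + h]%classic) (fun i => @segment_compact _ _ _).
by congr (compact _); apply/seteqP; split=> b H i; have := H i; rewrite /= in_itv.
Qed.

(** The support [S] is the image of a compact cube, hence closed in a Hausdorff space; so a chart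
    bump extended by 0 vanishes near every point outside the chart domain and is smooth there. *)
Lemma manifold_bump (x0 : M) (N : set M) : hausdorff_space M -> open N -> N x0 ->
  exists (rho : M -> R) (S : set M), [/\ closed S, S `<=` N,
    forall x, ~ S x -> rho x = 0, \forall x \near x0, rho x = 1 & smooth_in setT rho].
Proof.
move=> hM No Nx; pose c0 := chart_at A x0; pose a0 := cmap (ch c0) x0.
have cx0 : cdom (ch c0) x0 by exact: cdom_chart_at.
have ca0 : cimg (ch c0) a0 by exact: cimg_cmap.
have : \forall b \near a0, cimg (ch c0) b /\ N (cinv (ch c0) b).
  by apply: cinv_near => //; rewrite (cmapK cx0).
move=> /nbhs_ballP[s /= s0 sN].
(* The bump is supported in the closed cube of radius [2 r = s / 2], strictly inside the ball of
   radius [s]. *)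
pose r := s / 4%:R; have r0 : 0 < r by rewrite divr_gt0.
pose K := [set b : 'rV[R]_n | forall i, a0 0 i - 2%:R * r <= b 0 i <= a0 0 i + 2%:R * r].
have Ks : K `<=` ball a0 s.
  move=> b Kb; apply/ball_rV => // i; have := Kb i; rewrite -ball_normE /ball_/= ltr_norml.
  have -> : s = 4%:R * r by rewrite /r; field.
  move=> /andP[h1 h2]; apply/andP; split; lra.
pose S := cinv (ch c0) @` K.
have KN b : K b -> cimg (ch c0) b /\ N (cinv (ch c0) b) by move=> /Ks/sN.
have Sc : closed S.
  apply: compact_closed => //; apply: continuous_compact; last exact: cube_rV_compact.
  by apply: continuous_subspaceW (@cinv_cont _ _ _ (ch c0)) => b /KN[].
have SN : S `<=` N by move=> x [b /KN[_ Nb] <-].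
have Sdom : S `<=` cdom (ch c0) by move=> x [b /KN[/cimgK[cb _] _] <-].
pose rho x := if `[< cdom (ch c0) x >] then bump_fun a0 r (cmap (ch c0) x) else 0.
have rho0 x : ~ S x -> rho x = 0.
  move=> nS; rewrite /rho; case: asboolP => // cx.
  apply/eqP; apply: contra_notT nS => /bump_neq0-/(_ r0) Kx.
  by exists (cmap (ch c0) x) => //; exact: cmapK.
exists rho, S; split=> //.
  have n1 : \forall x \near x0, cdom (ch c0) x.
    by apply: open_nbhs_nbhs; split=> //; exact: cdom_open.
  have n2 : \forall x \near x0, ball a0 r (cmap (ch c0) x).
    by apply: (cmap_cts cx0); exact: nbhsx_ballx.
  apply: filterS2 n1 n2 => x cx bx; rewrite /rho; move/asboolP : cx => ->.
  exact: bump_eq1.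
apply: smooth_in_near; first exact: openT.
move=> x _; have [cx|ncx] := pselect (cdom (ch c0) x); last first.
  exists (~` S), (fun=> 0); split=> //.
  - exact: closed_openC.
  - by move=> /Sdom.
  - exact: smooth_in_cst.
  have : \forall y \near x, (~` S) y.
    by apply: open_nbhs_nbhs; split; [exact: closed_openC|move=> /Sdom].
  by apply: filterS => y /rho0.
exists (cdom (ch c0)), rho; split=> //; first exact: cdom_open.
  move=> c m; apply: (@Ck_eq _ _ _ _ _ (fun b => bump_fun a0 r (transition (ch c) (ch c0) b))).
  - exact/chart_preimage_open/cdom_open.
  - by move=> b [cb c0b]; rewrite /rho/=; move/asboolP : c0b => ->.
  apply: (@Ck_comp_rV _ _ m _ _ setT) => //; first exact/chart_preimage_open/cdom_open.
    exact: transition_Ck.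
  exact: bump_Ck.
exact: nearW.
Qed.

(** * Locally constant cocycles as differences of smooth functions *)

Section Cech.
Variables (N S : nat -> set M) (rho : nat -> M -> R) (u : nat -> nat -> M -> R).
Hypotheses (No : forall k, open (N k)) (Sc : forall k, closed (S k)).
Hypotheses (SN : forall k, S k `<=` N k) (rhoS : forall k x, ~ S k x -> rho k x = 0).
Hypothesis rho_smooth : forall k, smooth_in setT (rho k).
Hypothesis rho_cover : forall x : M, exists k, \forall y \near x, rho k y = 1.
Hypothesis u_const : forall j k x, N j x -> N k x -> \forall y \near x, u j k y = u j k x.
Hypothesis u_cocycle : forall i j k x, N i x -> N j x -> N k x ->
  u i k x = u i j x + u j k x.

(* The weights sum to 1 and are locally finite without paracompactness: near a
   point where rho_k = 1 in a neighbourhood, the weights of index > k vanish. *)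
Definition cech_weight k x := rho k x * \prod_(j < k) (1 - rho j x).

Lemma cech_weight_notS k x : ~ S k x -> cech_weight k x = 0.
Proof. by move=> nS; rewrite /cech_weight rhoS// mul0r. Qed.

Lemma cech_weight_stable k m x : rho k x = 1 -> (k < m)%N -> cech_weight m x = 0.
Proof.
move=> r1 km; rewrite /cech_weight (bigD1 (Ordinal km))//= r1 subrr mul0r mulr0 //.
Qed.

Lemma cech_weight_sum m x : \sum_(k < m) cech_weight k x = 1 - \prod_(k < m) (1 - rho k x).
Proof.
elim: m => [|m IH]; first by rewrite !big_ord0 subrr.
rewrite !big_ord_recr/= IH /cech_weight; ring.
Qed.

Lemma cech_weight_smooth k : smooth_in setT (cech_weight k).
Proof.
apply: smooth_inM => //; first exact: openT.
apply: smooth_in_prod; first exact: openT.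
by move=> j; apply: smooth_inB; [exact: openT|exact: smooth_in_cst|exact: rho_smooth].
Qed.

Lemma cech_weight_sum_stable (F : nat -> R) k m m' x : rho k x = 1 -> (k < m)%N -> (k < m')%N ->
  \sum_(i < m) cech_weight i x * F i = \sum_(i < m') cech_weight i x * F i.
Proof.
move=> r1; wlog mm' : m m' / (m <= m')%N.
  by move=> H km km'; have [/H|/ltnW/H ->//] := leqP m m'; exact.
move=> km km'; rewrite -(subnKC mm') big_split_ord/= [X in _ = _ + X]big1 ?addr0// => i _.
by rewrite (cech_weight_stable r1) ?mul0r//= (leq_trans km)// leq_addr.
Qed.

(** [u j k] is controlled only on the overlap of [N j] and [N k]; at a point outside [N k] the
    weight vanishes in a neighbourhood because [S k] is closed. *)
Lemma cech_term_smooth j k : smooth_in (N j) (fun x => cech_weight k x * u j k x).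
Proof.
apply: smooth_in_near => // x Nx; have [Nk|nNk] := pselect (N k x).
  exists setT, (fun y => cech_weight k y * u j k x); split=> //; first exact: openT.
    by apply: smooth_inM; [exact: openT|exact: cech_weight_smooth|exact: smooth_in_cst].
  by have := u_const Nx Nk; apply: filterS => y ->.
exists setT, (fun=> 0); split=> //; [exact: openT|exact: smooth_in_cst|].
have : \forall y \near x, (~` S k) y.
  by apply: open_nbhs_nbhs; split; [exact: closed_openC|move=> /SN].
by apply: filterS => y /cech_weight_notS ->; rewrite mul0r.
Qed.

(** The usual formula: h_j is the sum over k of w_k u_jk. By the cocycle rule each term of h_i - h_j
    is w_k u_ij, and the weights sum to 1. *)
Lemma cech_primitive : exists h : nat -> M -> R,
  (forall j, smooth_in (N j) (h j)) /\
  (forall i j x, N i x -> N j x -> h i x - h j x = u i j x).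
Proof.
have /choice[m Hm] := rho_cover.
exists (fun j x => \sum_(k < (m x).+1) cech_weight k x * u j k x); split=> [j|i j x Ni Nj].
  (* The truncation order [m y] varies with [y]; near [x] it may be replaced by the fixed [m x], as
     all further weights vanish for either truncation. *)
  apply: smooth_in_near => // x Nx.
  exists (N j), (fun y => \sum_(k < (m x).+1) cech_weight k y * u j k y); split=> //.
    apply: smooth_in_sum => // k; exact: cech_term_smooth.
  have := Hm x; apply: filterS => y r1.
  have r2 := nbhs_singleton (Hm y).
  transitivity (\sum_(k < (maxn (m x) (m y)).+1) cech_weight k y * u j k y).
    by apply: (cech_weight_sum_stable (fun k => u j k y) r1); rewrite ltnS// leq_maxl.
  by apply: (cech_weight_sum_stable (fun k => u j k y) r2); rewrite ltnS// leq_maxr.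
have r1 := nbhs_singleton (Hm x).
rewrite -sumrB (eq_bigr (fun k : 'I_(m x).+1 => cech_weight k x * u i j x)); last first.
  move=> k _; have [Sk|nS] := pselect (S k x); last by rewrite cech_weight_notS// !mul0r subrr.
  by rewrite (@u_cocycle i j k)//; [ring|exact: SN].
(* The sum runs up to [m x] inclusive, so the remaining product contains the factor
   [1 - rho (m x) x = 0]. *)
rewrite -mulr_suml cech_weight_sum (bigD1 ord_max)//= r1 subrr mul0r subr0 mul1r //.
Qed.

End Cech.

(** * From a locally constant discrepancy to an exact 1-form *)

Section DeRham.
Variables (N : nat -> set M) (h : nat -> M -> R).
Hypotheses (No : forall k, open (N k)) (N_cover : forall x, exists k, N k x).
Hypothesis h_smooth : forall j, smooth_in (N j) (h j).
Hypothesis h_const : forall i j x, N i x -> N j x ->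
  \forall y \near x, h i y - h j y = h i x - h j x.

Let jx (x : M) : nat := projT1 (cid (N_cover x)).
Let jxP x : N (jx x) x.
Proof. exact: (projT2 (cid (N_cover x))). Qed.

(* The closed 1-form that is d h_j over each N_j; h_i - h_j is locally constant,
   so the choice of j does not matter. *)
Definition dh (z : TM R n M) : R :=
  'D_(z.2) (h (jx z.1) \o cinv (ch (chart_at A z.1))) (cmap (ch (chart_at A z.1)) z.1).

Lemma h_diff j c a : chart_preimage c (N j) a -> differentiable (h j \o cinv (ch c)) a.
Proof. by move=> Na; exact: (Ck_diff (h_smooth j c 0)). Qed.

Lemma h_chart_const i j c a : chart_preimage c (N i) a -> chart_preimage c (N j) a ->
  \forall b \near a, h i (cinv (ch c) b) - h j (cinv (ch c) b) =
    h i (cinv (ch c) a) - h j (cinv (ch c) a).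
Proof. by move=> [ca Ni] [_ Nj]; have := cinv_cts ca (h_const Ni Nj); exact. Qed.

(** [dh] is defined pointwise with an arbitrary index and the preferred chart, both of which may
    jump. Here it is seen to be the differential of any admissible h_j in any chart, from which
    smoothness and closedness follow. *)
Lemma loc_dh j c a v : chart_preimage c (N j) a ->
  loc_fun (A := A) dh c (a, v) = 'D_v (h j \o cinv (ch c)) a.
Proof.
move=> [ca Na]; rewrite /loc_fun /dh/=.
set x := cinv (ch c) a; set k := chart_at A x.
have cka : overlap c k a by exact: overlap_chart_at.
have -> : cmap (ch k) x = transition (ch c) (ch k) a by [].
set T := transition (ch c) (ch k).
have kT : cimg (ch k) (T a) by exact: transition_cimg.
have xT : cinv (ch k) (T a) = x by exact: transition_cinv.
have p1 : chart_preimage k (N (jx x)) (T a) by split=> //; rewrite xT; exact: jxP.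
have p2 : chart_preimage k (N j) (T a) by split=> //; rewrite xT.
have -> : 'D_('D_v T a) (h (jx x) \o cinv (ch k)) (T a) = 'D_('D_v T a) (h j \o cinv (ch k)) (T a).
  apply/eqP; rewrite -subr_eq0 -deriveB; last 2 first.
  - exact/diff_derivable/h_diff.
  - exact/diff_derivable/h_diff.
  have E := h_chart_const p1 p2.
  rewrite (@near_eq_derive _ _ _ _ (cst (h (jx x) (cinv (ch k) (T a)) - h j (cinv (ch k) (T a))))) ?derive_cst//.
rewrite -(derive_comp_vec _ (transition_diff cka) (h_diff p2)).
apply: near_eq_derive; apply: (open_near (@overlap_open _ _ _ A c k) cka) => b cb /=.
by rewrite transition_cinv.
Qed.

Lemma dh_one_form : one_form A dh.
Proof.
split=> [x a u v|c].
  have x1 : chart_preimage (chart_at A x) (N (jx x)) (cmap (ch (chart_at A x)) x).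
    split; first exact/cimg_cmap/cdom_chart_at.
    by rewrite (cmapK (cdom_chart_at A x)); exact: jxP.
  by rewrite /dh/= derive_linear//; exact: h_diff.
apply/smooth_onP => m; apply: Ck_near => p cp.
have [j Nj] := N_cover (cinv (ch c) p.1).
pose E := [set q : 'rV[R]_n * 'rV[R]_n | chart_preimage c (N j) q.1].
have Eo : open E.
  rewrite openE => q Eq; rewrite /interior/=.
  by apply: (fst_near (O := chart_preimage c (N j))); apply: open_nbhs_nbhs; split=> //; exact: chart_preimage_open.
exists E, (fun q : 'rV[R]_n * 'rV[R]_n => \sum_k q.2 0 k * 'D_(ebasis R k) (h j \o cinv (ch c)) q.1); split=> //.
  apply: Ck_sum => // k; apply: CkM => //.
    by apply: Ck_coord => //; exact: Ck_snd.
  exact: (Ck_comp_rV (f := fst) (h := fun b => 'D_(ebasis R k) (h j \o cinv (ch c)) b) Eo (fun q Eq => Eq)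
    (@Ck_fst _ _ m E) (CkS_derive _ (h_smooth j c m.+1))).
have Ep : E p by split.
apply: (open_near Eo Ep) => q Eq; rewrite [q in RHS]surjective_pairing (loc_dh _ Eq).
by rewrite [in RHS](row_delta_sum q.2) derive_sumv//; exact: h_diff.
Qed.

Lemma dh_closed : closed_form A dh.
Proof.
move=> c a ca i k; have [j Nj] := N_cover (cinv (ch c) a).
have Wo := @chart_preimage_open c _ (No j).
have Wa : chart_preimage c (N j) a by split.
have E l : \forall b \near a, loc_fun (A := A) dh c (b, ebasis R l) = 'D_(ebasis R l) (h j \o cinv (ch c)) b.
  by apply: (open_near Wo Wa) => b Wb; exact: loc_dh.
apply: etrans (near_eq_derive _ (E k)) _.
apply: etrans _ (esym (near_eq_derive _ (E i))).
exact: schwarz Wo (h_smooth j c 2) Wa.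
Qed.

Lemma deRham_primitive : H1dR_trivial A ->
  exists f : M -> R, forall j x, N j x -> \forall y \near x, f y - h j y = f x - h j x.
Proof.
move=> /(_ _ dh_one_form dh_closed)[f [f_smooth fE]].
exists f => j x Nx; pose c := chart_at A x; pose a := cmap (ch c) x.
have cx : cdom (ch c) x by exact: cdom_chart_at.
have Wo := @chart_preimage_open c _ (No j).
have Wa : chart_preimage c (N j) a by split; [exact: cimg_cmap|rewrite (cmapK cx)].
have /nbhs_ballP[r /= r0 rW] : nbhs a (chart_preimage c (N j)) by exact: open_nbhs_nbhs.
have df b : chart_preimage c (N j) b -> differentiable (f \o cinv (ch c)) b.
  by move=> [cb _]; exact: smooth_on_diff (f_smooth c) cb.
have C := @derive0_const _ _ ((f \o cinv (ch c)) - (h j \o cinv (ch c))) a r r0.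
have {}C b : ball a r b -> f (cinv (ch c) b) - h j (cinv (ch c) b) =
    f (cinv (ch c) a) - h j (cinv (ch c) a).
  apply: C => [y /rW Wy|y v /rW Wy]; first by apply: differentiableB; [exact: df|exact: h_diff].
  rewrite deriveB; [|exact/diff_derivable/df|exact/diff_derivable/h_diff].
  by rewrite -(loc_dh v Wy) fE ?subrr//; case: Wy.
have n1 : \forall y \near x, cdom (ch c) y by apply: open_nbhs_nbhs; split=> //; exact: cdom_open.
have n2 : \forall y \near x, ball a r (cmap (ch c) y) by apply: (cmap_cts cx); exact: nbhsx_ballx.
apply: filterS2 n1 n2 => y cy by_; have := C _ by_.
by rewrite (cmapK cy) (cmapK cx).
Qed.

End DeRham.

End SmoothManifold.

(** * Globalisation *)

Lemma derive_near_scale (R : realType) (V : normedModType R) (f g : V -> R) (k : R) p v :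
  (\forall q \near p, f q = k * g q) -> differentiable g p ->
  'D_v f p = k * 'D_v g p.
Proof.
move=> fg dg; rewrite (@near_eq_derive _ _ _ _ (k *: g)) ?deriveZ//.
exact: diff_derivable.
Qed.

Section ScaledMetric.
#[local] Opaque derive.
Context {R : realType} {n : nat}.
Variables (f g : 'rV[R]_n * 'rV[R]_n -> R) (k : R) (W : set ('rV[R]_n * 'rV[R]_n)).
Hypotheses (Wo : open W) (Wg : forall m, Ck m W g) (k0 : k != 0).

Lemma derive_scale p v : W p -> (\forall q \near p, f q = k * g q) ->
  'D_v f p = k * 'D_v g p.
Proof. by move=> Wp fg; apply: derive_near_scale => //; exact: (Ck_diff (Wg 0)). Qed.

Lemma derive2_scale p v w : W p -> (\forall q \near p, f q = k * g q) ->
  'D_v (fun q => 'D_w f q) p = k * 'D_v (fun q => 'D_w g q) p.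
Proof.
move=> Wp fg; apply: derive_near_scale; last exact: (Ck_diff (CkS_derive w (Wg 1))).
have Wn : \forall q \near p, W q by exact: open_nbhs_nbhs.
by apply: filterS2 Wn (near_join fg) => q Wq fgq; exact: derive_scale.
Qed.

Lemma gmx_scale p : W p -> (\forall q \near p, f q = k * g q) -> gmx f p = k *: gmx g p.
Proof.
move=> Wp fg; apply/matrixP => i j; rewrite !mxE /dy.
have Wn : \forall q \near p, W q by exact: open_nbhs_nbhs.
have dg2 q w : W q -> 'D_w (fun q => g q / 2%:R) q = 2%:R^-1 * 'D_w g q.
  move=> Wq; apply: derive_near_scale; last exact: (Ck_diff (Wg 0)).
  by apply: (open_near Wo Wq) => z _; rewrite mulrC.
have df2 q w : W q -> (\forall q \near q, f q = k * g q) ->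
    'D_w (fun q => f q / 2%:R) q = k * (2%:R^-1 * 'D_w g q).
  move=> Wq fgq; rewrite mulrA; apply: derive_near_scale; last exact: (Ck_diff (Wg 0)).
  by apply: filterS fgq => z ->; rewrite mulrAC.
have E1 : 'D_(0, ebasis R j) (fun q => 'D_(0, ebasis R i) (fun q => f q / 2%:R) q) p =
   (k * 2%:R^-1) * 'D_(0, ebasis R j) (fun q => 'D_(0, ebasis R i) g q) p.
  apply: derive_near_scale; last exact: (Ck_diff (CkS_derive _ (Wg 1))).
  by apply: filterS2 Wn (near_join fg) => q Wq fgq; rewrite df2// mulrA.
have E2 : 'D_(0, ebasis R j) (fun q => 'D_(0, ebasis R i) (fun q => g q / 2%:R) q) p =
   2%:R^-1 * 'D_(0, ebasis R j) (fun q => 'D_(0, ebasis R i) g q) p.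
  apply: derive_near_scale; last exact: (Ck_diff (CkS_derive _ (Wg 1))).
  by apply: filterS Wn => q Wq; rewrite dg2.
by rewrite [LHS]E1 [X in _ = _ * X]E2 mulrA.
Qed.

(** The inverse of [gmx] scales by [k^-1] and the bracket by [k], so a constant factor, of either
    sign, leaves the spray unchanged. *)
Lemma spray_formula_scale p i : W p -> (\forall q \near p, f q = k * g q) ->
  gmx g p \in unitmx ->
  \sum_(l < n) invmx (gmx f p) i l *
    ((\sum_(m < n) dy l (dx m f) p * p.2 0 m) - dx l f p) =
  \sum_(l < n) invmx (gmx g p) i l *
    ((\sum_(m < n) dy l (dx m g) p * p.2 0 m) - dx l g p).
Proof.
move=> Wp fg gU; apply: eq_bigr => l _.
rewrite (gmx_scale Wp fg) invmxZ ?unitmxZ ?unitfE// mxE.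
have E1 : dx l f p = k * dx l g p by exact: derive_scale.
have E2 m : dy l (dx m f) p = k * dy l (dx m g) p by exact: derive2_scale.
have E3 : \sum_(m < n) dy l (dx m f) p * p.2 0 m = k * \sum_(m < n) dy l (dx m g) p * p.2 0 m.
  by rewrite mulr_sumr; apply: eq_bigr => m _; rewrite E2 mulrA.
have gen (Y a b : R) : k^-1 * Y * (k * a - k * b) = Y * (a - b).
  by rewrite -mulrBr mulrACA mulVf// mul1r.
exact: etrans (congr2 (fun a b => k^-1 * invmx (gmx g p) i l * (a - b)) E3 E1) (gen _ _ _).
Qed.

End ScaledMetric.

Section Global.
#[local] Opaque derive.
Context {R : realType} {n : nat} {M : topologicalType}.
Variables (A : smooth_atlas R n M) (G : regular_spray A).

(** Smoothness, nondegeneracy and the spray formula are local and survive a nonzero constant factor.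
    Homogeneity compares distant points of a ray and needs a separate argument. *)
Lemma good_global_metric (Psi : TM R n M -> R) :
  (forall c p, loc_set (A := A) (@T0M R n M) c p -> good G c p (loc_fun (A := A) Psi c)) ->
  globally_metrizable G.
Proof.
move=> HP; exists (fun z => expR (Psi z)).
have [To Tc _] := coef_region G.
have key c p : loc_set (A := A) (@T0M R n M) c p -> exists U L k,
    [/\ local_metric G U L, loc_set (A := A) U c p, k != 0 &
    \forall q \near p, loc_fun (A := A) (fun z => expR (Psi z)) c q = k * loc_fun (A := A) L c q].
  exact: HP.
split; last first.
  move=> c p /key[U [L [k [UL Up k0 E]]]] i.
  have Wo : open (loc_set (A := A) U c) := metric_open UL.
  have Wg := metric_Ck c UL.
  rewrite (spray_formula_scale Wo Wg k0 i Up E); last exact: metric_unit UL _ Up.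
  exact: metric_spray UL _ Up i.
split=> //; first by move=> z _; rewrite gt_eqF// expR_gt0.
split.
- move=> c; apply/smooth_onP => m; apply: Ck_near => p /key[U [L [k [UL Up k0 E]]]].
  exists (loc_set (A := A) U c), (fun q => k * loc_fun (A := A) L c q); split=> //.
  + exact: metric_open UL.
  + by apply: CkZ; [exact: metric_open UL|exact: metric_Ck UL m].
  + by apply: filterS E => q ->.
- move=> x v l l0 v0; pose c := chart_at A x; pose a := cmap (ch c) x.
  have ca : cimg (ch c) a by exact/cimg_cmap/cdom_chart_at.
  have tE s : tvec c (a, s *: v) = (x, s *: v) by exact: tvec_chart_at.
  (* Near each [s] the numerator is a constant times a local metric, which is homogeneous; so [h] is
     locally constant on the connected half-line, and its values at 1 and [l] agree. *)
  pose h s := expR (Psi (x, s *: v)) / s ^+ 2.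
  have lc (s : R) : 0 < s -> \forall t \near s, h t = h s.
    move=> s0; have sv : loc_set (A := A) (@T0M R n M) c (a, s *: v).
      by apply/loc_set_T0M; split=> //=; rewrite scaler_eq0 negb_or gt_eqF.
    have [U [L [k [UL Up k0 E]]]] := key _ _ sv.
    have Lh t : 0 < t -> loc_fun (A := A) L c (a, t *: v) = (t / s) ^+ 2 * loc_fun (A := A) L c (a, s *: v).
      move=> t0; have -> : t *: v = (t / s) *: (s *: v) by rewrite scalerA divfK// gt_eqF.
      by apply: (metric_homog UL) => //; rewrite divr_gt0.
    have Ev : \forall t \near s, expR (Psi (x, t *: v)) = k * loc_fun (A := A) L c (a, t *: v).
      have cc : {for s, continuous (fun t : R => (a, t *: v))}.
        have c1 : (fun=> a) t @[t --> s] --> a by exact: cvg_cst.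
        have c2 : t *: v @[t --> s] --> s *: v by apply: cvgZ; [exact: cvg_id|exact: cvg_cst].
        exact: (cvg_pair c1 c2).
      have Ec : \forall t \near s, loc_fun (A := A) (fun z => expR (Psi z)) c (a, t *: v) =
          k * loc_fun (A := A) L c (a, t *: v) by exact: (cc _ E).
      by apply: filterS Ec => t Et; rewrite -Et /loc_fun tE.
    have n0 : \forall t \near s, 0 < t by apply: open_nbhs_nbhs; split=> //; exact: open_gt.
    have Es := nbhs_singleton Ev.
    apply: filterS2 Ev n0 => t Et t0.
    rewrite /h Et Es (Lh t t0).
    move: (loc_fun _ _ _) => y; field; by rewrite !gt_eqF.
  have cD : convex_in [set s : R | 0 < s].
    move=> s t r s0 t0 /andP[r0 r1] /=.
    have -> : r *: (t - s) + s = r * t + (1 - r) * s by rewrite /GRing.scale/=; ring.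
    have [->|rn0] := eqVneq r 0; first by rewrite mul0r add0r subr0 mul1r.
    by rewrite ltr_wpDr ?mulr_ge0 ?subr_ge0 ?(ltW s0)// mulr_gt0// lt_def rn0.
  have := locally_constant_convex cD lc (ltr01 : [set s : R | 0 < s] 1) l0.
  rewrite /h scale1r expr1n divr1 => <-.
  by rewrite mulrC divfK// expf_neq0// gt_eqF.
move=> c p /key[U [L [k [UL Up k0 E]]]].
rewrite (gmx_scale (metric_open UL) (metric_Ck c UL) Up E) unitmxZ ?unitfE//.
exact: metric_unit UL _ Up.
Qed.

Definition good_on (N : set M) (Phi : TM R n M -> R) :=
  forall c p, loc_set (A := A) (@T0M R n M) c p -> N (cinv (ch c) p.1) ->
    good G c p (loc_fun (A := A) Phi c).

Hypotheses (n3 : (3 <= n)%N) (Gs : scalar_curvature G) (Gr : ricci_neq0_ae G).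

Let n_gt0 : (0 < n)%N := leq_trans (isT : (0 < 3)%N) n3.

Lemma good_on_chart (x0 : M) : locally_metrizable G ->
  exists N Phi, [/\ open N, N x0 & good_on N Phi].
Proof.
move=> Gl; pose c := chart_at A x0; pose a0 := cmap (ch c) x0.
have ca0 : cimg (ch c) a0 by exact/cimg_cmap/cdom_chart_at.
have /nbhs_ballP[r /= r0 rc] := cimg_near ca0.
have [|phi Hphi] := @punctured_section R n (good G c) (@good_ext _ _ _ _ _ c)
  (@good_uniq _ _ _ _ _ Gs Gr c) (@good_shift _ _ _ _ _ c) (@good_open _ _ _ _ _ c) (ball a0 r)
  (@ball_open _ _ _ _) (@ball_convex _ _ _ _) _ n3.
  by move=> p Bp p0; apply: good_exists => //; apply/loc_set_T0M; split=> //; exact: rc.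
pose N := [set x | cdom (ch c) x /\ ball a0 r (cmap (ch c) x)].
(* The section [phi] lives in the coordinates of [c], while [z] carries components of its own
   preferred chart, hence the change of coordinates; values off [N] are irrelevant. *)
pose Phi (z : TM R n M) := phi (@Ttransition _ _ _ A (chart_at A z.1) c
  (cmap (ch (chart_at A z.1)) z.1, z.2)).
exists N, Phi; split.
- rewrite openE => x [cx bx]; rewrite /interior/=.
  have n1 : \forall y \near x, cdom (ch c) y by apply: open_nbhs_nbhs; split=> //; exact: cdom_open.
  have n2 : \forall y \near x, ball a0 r (cmap (ch c) y).
    by apply: (cmap_cts cx); apply: open_nbhs_nbhs; split=> //; exact: ball_open.
  by apply: filterS2 n1 n2.
- by split; [exact: cdom_chart_at|exact: ballxx].
move=> i p /loc_set_T0M[ip p0] [cx bx].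
have icp : overlap i c p.1 by split.
have : good G i p (phi \o @Ttransition _ _ _ A i c).
  apply: good_transfer => //; apply: Hphi; first exact: bx.
  apply: contra p0 => /eqP/= h; apply/eqP; exact: derive_transition_eq0 icp h.
move=> /good_ext; apply.
have ov : \forall q \near p, overlap i c q.1.
  by apply: (fst_near (O := overlap i c)); apply: open_nbhs_nbhs; split=> //; exact: overlap_open.
apply: filterS ov => q icq; rewrite /loc_fun /Phi /=.
set k := chart_at A _; have ikq : overlap i k q.1 by apply: overlap_chart_at; case: icq.
have -> : (cmap (ch k) (cinv (ch i) q.1), 'D_(q.2) (transition (ch i) (ch k)) q.1) =
   @Ttransition _ _ _ A i k q by [].
by rewrite Ttransition_trans.
Qed.

(** One constant serves all nonzero vectors over a neighbourhood of [x], because the punctured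
    fibres are connected; so the discrepancy is a function on the base. *)
Lemma good_on_uniq N Phi N' Phi' x : open N -> open N' -> good_on N Phi -> good_on N' Phi' ->
  N x -> N' x -> exists a, \forall y \near x, forall v, v != 0 -> Phi (y, v) = Phi' (y, v) + a.
Proof.
move=> No No' gN gN' Nx Nx'; pose c := chart_at A x; pose a0 := cmap (ch c) x.
have cx : cdom (ch c) x by exact: cdom_chart_at.
have ca0 : cimg (ch c) a0 by exact: cimg_cmap.
have : \forall b \near a0, cimg (ch c) b /\ (N `&` N') (cinv (ch c) b).
  by apply: cinv_near => //; [exact: openI|rewrite (cmapK cx)].
move=> /nbhs_ballP[r /= r0 rN].
have [||a Ha] := @punctured_uniq R n (good G c)
  (@good_uniq _ _ _ _ _ Gs Gr c) (ball a0 r)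
  (@ball_convex _ _ _ _) (loc_fun (A := A) Phi c) (loc_fun (A := A) Phi' c) n3.
- by move=> p /rN[cp [Np _]] p0; apply: gN => //; apply/loc_set_T0M.
- by move=> p /rN[cp [_ Np]] p0; apply: gN' => //; apply/loc_set_T0M.
exists a.
have n1 : \forall y \near x, cdom (ch c) y by apply: open_nbhs_nbhs; split=> //; exact: cdom_open.
have n2 : \forall y \near x, ball a0 r (cmap (ch c) y) by apply: (cmap_cts cx); exact: nbhsx_ballx.
apply: filterS2 n1 n2 => y cy by_ v v0.
pose k := chart_at A y; pose p : 'rV[R]_n * 'rV[R]_n := (cmap (ch k) y, v).
have kcp : overlap k c p.1.
  by split; [exact/cimg_cmap/cdom_chart_at|rewrite /= (cmapK (cdom_chart_at A y))].
have tE : tvec c (@Ttransition _ _ _ A k c p) = (y, v).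
  by rewrite tvec_Ttransition//; exact: tvec_chart_at.
have := Ha (@Ttransition _ _ _ A k c p); rewrite /loc_fun tE; apply.
  by rewrite /= /transition/= (cmapK (cdom_chart_at A y)).
by apply: contra v0 => /eqP/= h; apply/eqP; exact: derive_transition_eq0 kcp h.
Qed.

(** The datum enumerated along the countable cover: a bump function, a closed set off which it
    vanishes, the open set containing it, and a local potential there. *)
Record packet := Packet {
  pk_rho : M -> R; pk_S : set M; pk_N : set M; pk_Phi : TM R n M -> R }.

Definition valid_packet (d : packet) :=
  [/\ open (pk_N d), closed (pk_S d), pk_S d `<=` pk_N d,
      forall x, ~ pk_S d x -> pk_rho d x = 0 &
      smooth_in A setT (pk_rho d) /\ good_on (pk_N d) (pk_Phi d)].

Lemma local_to_global : hausdorff_space M -> @second_countable M ->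
  H1dR_trivial A -> locally_metrizable G -> globally_metrizable G.
Proof.
move=> hM sM H1 Gl.
have V0 : valid_packet (Packet (fun=> 0) set0 set0 (fun=> 0)).
  split=> //=; [exact: open0|exact: closed0|].
  by split; [exact: smooth_in_cst|].
have [x|s [Vs cov]] := @lindelof M _ _ valid_packet (fun d => [set x | pk_rho d x = 1]) sM V0.
  have [N [Phi [No Nx gN]]] := good_on_chart x Gl.
  have [rho [S [Sc SN rS r1 rs]]] := manifold_bump A hM No Nx.
  by exists (Packet rho S N Phi).
pose N k := pk_N (s k); pose Phi k := pk_Phi (s k).
have No k : open (N k) by case: (Vs k).
have gN k : good_on (N k) (Phi k) by case: (Vs k) => _ _ _ _ [].
(* Any nonzero vector would do: the differences of potentials are constant on punctured fibres and
   are read off at [e]. *)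
pose e : 'rV[R]_n := const_mx 1.
have e0 : e != 0.
  apply/eqP => /rowP/(_ (Ordinal n_gt0)); rewrite !mxE => /eqP; by rewrite oner_eq0.
pose u j k x := Phi k (x, e) - Phi j (x, e).
have uE j k x : N j x -> N k x ->
    \forall y \near x, forall v, v != 0 -> Phi k (y, v) - Phi j (y, v) = u j k x.
  move=> Nj Nk; have [a Ha] := good_on_uniq (No k) (No j) (gN k) (gN j) Nk Nj.
  have ux : u j k x = a.
    by rewrite /u (nbhs_singleton Ha)// addrAC subrr add0r.
  by apply: filterS Ha => y Hy v v0; rewrite ux (Hy v v0) addrAC subrr add0r.
have u_const j k x : N j x -> N k x -> \forall y \near x, u j k y = u j k x.
  by move=> Nj Nk; apply: filterS (uE j k x Nj Nk) => y /(_ e e0).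
have [h [hs hE]] : exists h : nat -> M -> R, (forall j, smooth_in A (N j) (h j)) /\
    (forall i j x, N i x -> N j x -> h i x - h j x = u i j x).
  apply: (@cech_primitive _ _ _ A N (fun k => pk_S (s k)) (fun k => pk_rho (s k))) => //.
  - by move=> k; case: (Vs k).
  - by move=> k; case: (Vs k).
  - by move=> k; case: (Vs k).
  - by move=> k; case: (Vs k) => _ _ _ _ [].
  - by move=> i j k x _ _ _; rewrite /u; ring.
have Ncov x : exists k, N k x.
  have [k rk] := cov x; exists k; case: (Vs k) => _ _ SN rS _; apply: SN.
  apply: contrapT => /rS; have := nbhs_singleton rk; rewrite /= => -> /eqP.
  by rewrite oner_eq0.
have hc i j x : N i x -> N j x -> \forall y \near x, h i y - h j y = h i x - h j x.
  move=> Ni Nj; have n1 : \forall y \near x, N i y by exact: open_nbhs_nbhs.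
  have n2 : \forall y \near x, N j y by exact: open_nbhs_nbhs.
  near=> y; rewrite !hE//; [|by near: y|by near: y].
  by near: y; exact: u_const.
have [F HF] := deRham_primitive No Ncov hs hc H1.
have /choice[jx Hjx] := Ncov.
(* The choice [jx] may jump, but [hE] makes [Phi j + h j] the same for all admissible [j]. For a
   fixed [j] the correction [h j - F] is locally constant, so near [p] this is [Phi j] shifted by a
   constant. *)
pose Psi (z : TM R n M) := Phi (jx z.1) z + (h (jx z.1) z.1 - F z.1).
apply: (@good_global_metric Psi) => c p cp.
have [cimgp p0] := (loc_set_T0M c p).1 cp.
pose x := cinv (ch c) p.1; have [j Nj] := Ncov x.
have := good_shift (h j x - F x) (gN j c p cp Nj).
move=> /good_ext; apply.
have nT : \forall q \near p, loc_set (A := A) (@T0M R n M) c q.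
  apply: open_nbhs_nbhs; split=> //; have [To _ _] := coef_region G; exact: To.
have nx : \forall y \near x, N j y /\ h j y - F y = h j x - F x.
  have n1 : \forall y \near x, N j y by exact: open_nbhs_nbhs.
  apply: filterS2 n1 (HF j x Nj) => y Ny Fy; split=> //.
  by rewrite -opprB Fy opprB.
have nq : \forall q \near p, N j (cinv (ch c) q.1) /\
    h j (cinv (ch c) q.1) - F (cinv (ch c) q.1) = h j x - F x.
  apply: (fst_near (O := [set b | N j (cinv (ch c) b) /\
    h j (cinv (ch c) b) - F (cinv (ch c) b) = h j x - F x])).
  by have := cinv_cts cimgp nx; exact.
apply: filterS2 nT nq => q [_ q0] [Nq Eq].
rewrite /loc_fun /Psi -Eq.
have -> : (tvec c q).1 = cinv (ch c) q.1 by [].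
set y := cinv (ch c) q.1; set i := jx y.
have Ni : N i y by exact: Hjx.
have := nbhs_singleton (uE i j y Ni Nq) _ q0; rewrite -(hE i j y Ni Nq).
have -> : (y, (tvec c q).2) = tvec c q by [].
move: (Phi j _) (Phi i _) (h i y) (h j y) (F y) => a b a' b' f H.
by apply/eqP; rewrite -subr_eq0; apply/eqP; move: H => /eqP; rewrite -subr_eq0 => /eqP <-; ring.
Unshelve. all: by end_near. Qed.

End Global.

Theorem theorem1p1 (R : realType) (n : nat) (M : topologicalType)
    (A : smooth_atlas R n M) (G : regular_spray A)
    (n_ge3 : (3 <= n)%N)
    (M_hausdorff : hausdorff_space M)
    (M_second_countable : @second_countable M)
    (M_connected : connected [set: M])
    (M_H1 : H1dR_trivial A)
    (G_scalar : scalar_curvature G)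
    (G_ricci : ricci_neq0_ae G) :
  globally_metrizable G <-> locally_metrizable G.
Proof.
split; last exact: local_to_global.
move=> [L [Lm Li]] z z0; exists (@T0M R n M).
have [To Tc _] := coef_region G.
by split=> //; exists L.
Qed.
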